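(* Let $m>1$ and assume that the initial function $f_0$ is positive and bounded, i.e. $0<b_f\le f_0(X)\le B_f$. Consider either of two cases. Case 1: $x_e$ is the exact solution of $$\frac{f_{0}(X)}{m\big(\frac{f_0(X)}{\partial_X x}\big)^{m-1}}\partial_{t}x=-\partial_{X}\Big(\frac{f_0(X)}{\partial_X x}\Big),\quad X\in\Omega,\ t>0,\qquad x|_{\partial\Omega}=X|_{\partial\Omega},\quad x(X,0)=X,$$ and $x_h^n\in\mathcal{Q}$ is the numerical solution, with $x^0_{h,i}=X_i$, of $$\frac{f_{0}(X_{i})}{m\big(\frac{f_0(X)}{\widetilde{D}_h x_h^{n}}\big)_{i}^{m-1}}\cdot\frac{x^{n+1}_{h,i}-x^{n}_{h,i}}{\tau}=-d_{h}\Big(\frac{f_{0}(X)}{D_{h} x_h^{n+1}}\Big)_{i},\ 1\le i\le M-1,\qquad x^{n+1}_{h,0}=X_0,\ x^{n+1}_{h,M}=X_M,\quad 0\le n\le N-1.$$ Case 2: $x_e$ is the exact solution of $$\frac{(\partial_X x)^{m+1}}{m f_0(X)^m}\partial_t x=\partial_X\Big(\frac{\partial_X x}{f_0(X)}\Big),\quad X\in\Omega,\ t>0,\qquad x|_{\partial\Omega}=X|_{\partial\Omega},\quad x(X,0)=X,$$ and $x_h^n\in\mathcal{Q}$ is the numerical solution, with $x^0_{h,i}=X_i$, of $$\frac{(\widetilde{D}_h x_h^n)^{m+1}_i}{m f_0(X_i)^{m}}\cdot\frac{x^{n+1}_{h,i}-x^{n}_{h,i}}{\tau}=d_{h}\Big(\frac{D_h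 x_h^{n+1}}{f_0(X)}\Big)_{i},\ 1\le i\le M-1,\qquad x^{n+1}_{h,0}=X_0,\ x^{n+1}_{h,M}=X_M,\quad 0\le n\le N-1.$$ In either case assume that $x_e$ has enough regularity (as many bounded continuous derivatives in $(X,t)$ up to the boundary, on $[0,T]$, as required), and let the numerical error be defined pointwise by $e_i^n=x_{e,i}^n-x_{h,i}^n$, where $x_{e,i}^n=x_e(X_i,t^n)$, $x_e^n,x_h^n\in\mathcal{Q}$, $0\le i\le M$, $0\le n\le N$. Then there is a positive constant $C$ such that, for $n=0,\dots,N$: (i) $e^n=(e^n_0,\dots,e^n_M)$ satisfies $\|e^n\|_2\le C(\tau+h^2)$; (ii) $\widetilde{D}_he^n=(\widetilde{D}_he^n_0,\dots,\widetilde{D}_he^n_M)$ satisfies $\|\widetilde{D}_he^n\|_2\le C(\tau+h^2)$. Moreover, the error between the numerical solution $f_h^n$ and the exact solution $f_e^n$ of the porous medium problem satisfies $\|f_h^n-f_e^n\|_2\le C(\tau+h^2)$. Here $h$ is the spatial step, $\tau$ is the time step, and $C$ does not depend on $h$, $\tau$ or $n$.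
   Context: $\Omega\subset\mathbb{R}$ is a bounded interval with left endpoint $X_0$; $T>0$ is the final time; $N,M$ are positive integers; $\tau=T/N$, $t^n=n\tau$; $h=|\Omega|/M$; $X_r=X_0+rh$ for integer and half-integer $r$ (so $X_M$ is the right endpoint of $\Omega$). $\mathcal{E}_M$ is the space of real functions $l$ on $\{X_i: i=0,\dots,M\}$, with $l_i=l(X_i)$; $\mathcal{C}_M$ is the space of real functions $\phi$ on $\{X_{i-1/2}: i=1,\dots,M\}$, with $\phi_{i-1/2}=\phi(X_{i-1/2})$. Difference operators: $D_h:\mathcal{E}_M\to\mathcal{C}_M$, $(D_hl)_{i-1/2}=(l_i-l_{i-1})/h$, $1\le i\le M$; $(d_h\phi)_i=(\phi_{i+1/2}-\phi_{i-1/2})/h$, $1\le i\le M-1$, for $\phi\in\mathcal{C}_M$; $\widetilde D_h:\mathcal{E}_M\to\mathcal{E}_M$, $(\widetilde D_hl)_i=(l_{i+1}-l_{i-1})/(2h)$ for $1\le i\le M-1$, $(\widetilde D_hl)_0=(4l_1-l_2-3l_0)/(2h)$, $(\widetilde D_hl)_M=(l_{M-2}-4l_{M-1}+3l_M)/(2h)$. Products, quotients and powers of grid functions are pointwise. The function $f_0$ is evaluated at the points $X_i$ when combined with elements of $\mathcal{E}_M$, and at the half points $X_{i-1/2}$ when combined with elements of $\mathcal{C}_M$. Norm: $\|l\|_2^2=\langle l,l\rangle$, where $\langle l,g\rangle=h\big(\tfrac12l_0g_0+\sum_{i=1}^{M-1}l_ig_i+\tfrac12l_Mg_M\big)$ for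 $l,g\in\mathcal{E}_M$. Admissible set: $\mathcal{Q}=\{l\in\mathcal{E}_M: l_{i-1}<l_i \text{ for } 1\le i\le M,\ l_0=X_0,\ l_M=X_M\}$. The porous medium problem is $\partial_tf=\partial_{xx}(f^m)$ in $\Omega$, $t>0$, with $f(x,0)=f_0(x)$ and $\partial_xf=0$ on $\partial\Omega$. Along trajectories its exact solution is $f(x_e(X,t),t)=f_0(X)/\partial_Xx_e(X,t)$, and $f_{e,i}^n=f_0(X_i)/\partial_Xx_e(X_i,t^n)$. The numerical density is $f_{h,i}^n=f_0(X_i)/(\widetilde D_hx_h^n)_i$, $0\le i\le M$.
   Formalization: The bound on f_h^n − f_e^n is stated only for h ≤ h_0, with h_0 > 0 depending on the data only, since on coarse grids D̃_h x_h can vanish at an end point; M ≥ 2 is required so that D̃_h is defined, and ∂_X x_e > 0 is part of being an exact solution. *)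

(* Defs.v *)
From Stdlib Require Import Reals.
From Coquelicot Require Import Coquelicot.
Open Scope R_scope.

(** Grids on [a, b], [b] being the right endpoint [X_M].
    A grid function of E_M is a map [l : nat -> R] of which only the values
    [l 0, ..., l M] are relevant.  A grid function of C_M is a map
    [phi : nat -> R] of which only the values [phi 1, ..., phi M] are relevant,
    [phi i] being the value at the half point X_(i-1/2). *)

Definition step (a b : R) (M : nat) : R := (b - a) / INR M.
Definition node (a b : R) (M i : nat) : R := a + INR i * step a b M.
Definition half_node (a b : R) (M i : nat) : R :=
  a + (INR i - / 2) * step a b M.

Definition D_h (h : R) (l : nat -> R) (i : nat) : R := (l i - l (i - 1)%nat) / h.

Definition d_h (h : R) (phi : nat -> R) (i : nat) : R :=
  (phi (i + 1)%nat - phi i) / h.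

Definition Dt_h (h : R) (M : nat) (l : nat -> R) (i : nat) : R :=
  if Nat.eqb i 0 then (4 * l 1%nat - l 2%nat - 3 * l 0%nat) / (2 * h)
  else if Nat.eqb i M then
    (l (M - 2)%nat - 4 * l (M - 1)%nat + 3 * l M) / (2 * h)
  else (l (i + 1)%nat - l (i - 1)%nat) / (2 * h).

Definition inner (h : R) (M : nat) (l g : nat -> R) : R :=
  h * (/ 2 * l 0%nat * g 0%nat
       + sum_n_m (fun i => l i * g i) 1 (M - 1)
       + / 2 * l M * g M).

Definition norm2 (h : R) (M : nat) (l : nat -> R) : R := sqrt (inner h M l l).

Definition in_Q (a b : R) (M : nat) (l : nat -> R) : Prop :=
  (forall i, (1 <= i <= M)%nat -> l (i - 1)%nat < l i) /\
  l 0%nat = a /\ l M = b.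

(** [C^K] regularity up to the boundary of [a, b] x [0, T]: [x j k] is the
    partial derivative of [x 0 0] of order [j] in X and [k] in t.  [D_in] is the
    derivative within the closed interval, hence one-sided at its endpoints.
    The derivatives are bounded since they are continuous on a compact set. *)
Definition smooth_upto (K : nat) (a b T : R) (x : nat -> nat -> R -> R -> R)
  : Prop :=
  forall j k : nat,
    ((j + k <= K)%nat ->
       continuous_on (fun z : R * R => a <= fst z <= b /\ 0 <= snd z <= T)
                     (fun z : R * R => x j k (fst z) (snd z))) /\
    ((j + k < K)%nat -> forall X t, a <= X <= b -> 0 <= t <= T ->
       D_in (fun Y => x j k Y t) (fun Y => x (S j) k Y t)
            (fun Y => a <= Y <= b) X /\
       D_in (fun s => x j k X s) (fun s => x j (S k) X s)
            (fun s => 0 <= s <= T) t).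

(** Case 1 is the trajectory equation obtained from the energy density [f ln f],
    Case 2 the one obtained from [1 / (2 f)]. *)
Inductive traj_case := Case1 | Case2.

Definition trajectory_equation (c : traj_case) (m : R) (f0 : R -> R)
    (x : nat -> nat -> R -> R -> R) (X t : R) : Prop :=
  match c with
  | Case1 =>
      ex_derive (fun Y => f0 Y / x 1%nat 0%nat Y t) X /\
      f0 X / (m * Rpower (f0 X / x 1%nat 0%nat X t) (m - 1)) * x 0%nat 1%nat X t
      = - Derive (fun Y => f0 Y / x 1%nat 0%nat Y t) X
  | Case2 =>
      ex_derive (fun Y => x 1%nat 0%nat Y t / f0 Y) X /\
      Rpower (x 1%nat 0%nat X t) (m + 1) / (m * Rpower (f0 X) m)
        * x 0%nat 1%nat X t
      = Derive (fun Y => x 1%nat 0%nat Y t / f0 Y) X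
  end.

(** [0 < x 1 0 X t] is what makes the density [f0 / (d_X x)], and the real powers
    in the trajectory equation, meaningful ([Rpower] and [/] are total). *)
Definition exact_solution (c : traj_case) (a b T m : R) (f0 : R -> R)
    (x : nat -> nat -> R -> R -> R) : Prop :=
  (forall X t, a <= X <= b -> 0 <= t <= T -> 0 < x 1%nat 0%nat X t) /\
  (forall X t, a < X < b -> 0 < t <= T -> trajectory_equation c m f0 x X t) /\
  (forall t, 0 <= t <= T -> x 0%nat 0%nat a t = a /\ x 0%nat 0%nat b t = b) /\
  (forall X, a <= X <= b -> x 0%nat 0%nat X 0 = X).

Definition scheme_equation (c : traj_case) (a b tau m : R) (f0 : R -> R)
    (M : nat) (xold xnew : nat -> R) (i : nat) : Prop :=
  let h := step a b M in
  let X := node a b M in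
  let Xhalf := half_node a b M in
  match c with
  | Case1 =>
      f0 (X i) / (m * Rpower (f0 (X i) / Dt_h h M xold i) (m - 1))
        * ((xnew i - xold i) / tau)
      = - d_h h (fun j => f0 (Xhalf j) / D_h h xnew j) i
  | Case2 =>
      Rpower (Dt_h h M xold i) (m + 1) / (m * Rpower (f0 (X i)) m)
        * ((xnew i - xold i) / tau)
      = d_h h (fun j => D_h h xnew j / f0 (Xhalf j)) i
  end.

(** [x n i] is the numerical trajectory at time level [n] and node [i]. *)
Definition numerical_solution (c : traj_case) (a b T m : R) (f0 : R -> R)
    (N M : nat) (x : nat -> nat -> R) : Prop :=
  (forall n, (n <= N)%nat -> in_Q a b M (x n)) /\
  (forall i, (i <= M)%nat -> x 0%nat i = node a b M i) /\
  (forall n, (n < N)%nat ->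
     (forall i, (1 <= i <= M - 1)%nat ->
        scheme_equation c a b (T / INR N) m f0 M (x n) (x (S n)) i) /\
     x (S n) 0%nat = a /\ x (S n) M = b).

(* Main.v *)
Require Import Defs.
From Stdlib Require Import Reals Lra Lia Psatz ClassicalEpsilon.
From Coquelicot Require Import Coquelicot.
Open Scope R_scope.

(** Consistency and stability of the schemes give the rate, both of them uniformly in
    the ratio of [tau] to [h].

    Common form.  Put [q = f0 / d_X x].  Both trajectory equations amount to
    [d_X q = - (d_X x) (d_t x) q ^ (2 - m) / m] ([trajectory_equation_density]), and
    both schemes read
    [mobility * velocity = difference quotient of flux (D_h x / f0)], with
    [flux y = - 1 / y] in Case 1 and [flux y = y] in Case 2.  The mobility is evaluated
    at the old time level and is positive.

    A priori bounds.  A discrete maximum principle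
    ([implicit_step_maximum_principle]) keeps [D_h x_h / f0] between the bounds that it
    has initially.  All gradients therefore stay in a fixed compact subset of the
    positive half-line, on which mobility, flux and energy are under control.

    Consistency.  Although [f0] is merely bounded, the equation for [q] forces [q], and
    with it [f0], to have bounded derivatives in the open interval; all half nodes lie
    there.  Expansions that are symmetric about a node then give the truncation error
    [O(tau + h ^ 2)] ([flux_consistency], [truncation_error]).

    Stability.  Subtract the scheme from the perturbed scheme that the exact solution
    satisfies, and test with the time increment of the error ([energy_step]).  The flux
    is the derivative of a convex energy, so its contribution dominates the increment
    of the relative energy of the two gradients, up to [O(tau)] times the square of the
    gradient error.  The relative energy dominates that square
    ([relative_energy_coercive]), and Gronwall's inequality yields the rate for
    [D_h e] ([gradient_error]).

    Conclusion.  The rate for [e] follows by the discrete Poincare inequality, and that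
    for [Dt_h e] because [Dt_h] combines two neighbouring values of [D_h].  The density
    error is a multiple of the gradient error as soon as [Dt_h x_h] is bounded below,
    also at the ends of the interval, which is [Dt_h_lower_bound]. *)

(** * One-sided derivatives and Taylor inequalities *)

Lemma is_derive_D_in (f f' : R -> R) (D : R -> Prop) (x : R) :
  is_derive f x (f' x) -> D_in f f' D x.
Proof.
  intros H. apply is_derive_Reals in H. apply derivable_pt_lim_D_in in H.
  intros eps Heps. destruct (H eps Heps) as [d [Hd Hd']].
  exists d; split; [exact Hd|]. intros y [[_ Hy] Hxy]. apply Hd'.
  repeat split; auto.
Qed.

Lemma D_in_is_derive (f f' : R -> R) (a b x : R) :
  a < x < b -> D_in f f' (fun y => a <= y <= b) x -> is_derive f x (f' x).
Proof.
  intros Hx H. apply is_derive_Reals, derivable_pt_lim_D_in.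
  intros eps Heps. destruct (H eps Heps) as [d [Hd Hd']].
  exists (Rmin d (Rmin (x - a) (b - x))). split.
  - repeat apply Rmin_case; lra.
  - intros y [[_ Hy] Hxy]. simpl in Hxy. unfold Rdist in Hxy.
    assert (H1 := Rmin_l d (Rmin (x - a) (b - x))).
    assert (H2 := Rmin_r d (Rmin (x - a) (b - x))).
    assert (H3 := Rmin_l (x - a) (b - x)).
    assert (H4 := Rmin_r (x - a) (b - x)).
    apply Hd'. split; [split; [|exact Hy]|].
    + assert (H5 := Rabs_def2 _ _ Hxy). lra.
    + simpl. unfold Rdist. lra.
Qed.

Lemma clamp_in (a b y : R) : a <= b -> a <= Rmax a (Rmin b y) <= b.
Proof.
  intros H. split; [apply Rmax_l|]. apply Rmax_lub; [lra|apply Rmin_l].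
Qed.

Lemma clamp_id (a b y : R) : a <= y <= b -> Rmax a (Rmin b y) = y.
Proof. intros H. rewrite Rmin_right, Rmax_right; lra. Qed.

Lemma clamp_nonexpansive (a b y z : R) :
  Rabs (Rmax a (Rmin b y) - Rmax a (Rmin b z)) <= Rabs (y - z).
Proof.
  unfold Rmax, Rmin. repeat destruct Rle_dec;
  unfold Rabs; repeat destruct Rcase_abs; lra.
Qed.

(** One-sided derivatives at the endpoints suffice for the mean value theorem:
    precomposing with the projection onto [[a, b]] gives a function that is
    continuous on both sides everywhere and has the same inner derivatives. *)
Lemma mean_value_D_in (f f' : R -> R) (a b x y : R) :
  (forall z, a <= z <= b -> D_in f f' (fun z => a <= z <= b) z) ->
  a <= x <= b -> a <= y <= b ->
  exists z, a <= z <= b /\ Rabs (z - x) <= Rabs (y - x) /\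
            f y - f x = f' z * (y - x).
Proof.
  intros Hf Hx Hy.
  set (g := fun z => f (Rmax a (Rmin b z))).
  assert (Hmm : a <= Rmin x y /\ Rmax x y <= b).
  { split; [apply Rmin_glb|apply Rmax_lub]; lra. }
  destruct (MVT_gen g x y f') as [z [Hz Heq]].
  - intros z Hz. assert (Hab : a < z < b) by lra.
    assert (Hd := D_in_is_derive f f' a b z Hab (Hf z ltac:(lra))).
    apply is_derive_ext_loc with f; [|exact Hd].
    assert (Hpos : 0 < Rmin (z - a) (b - z)) by (apply Rmin_case; lra).
    exists (mkposreal _ Hpos). intros w Hw.
    unfold g. rewrite clamp_id; [reflexivity|].
    change (Rabs (w - z) < Rmin (z - a) (b - z)) in Hw.
    assert (H3 := Rmin_l (z - a) (b - z)).
    assert (H4 := Rmin_r (z - a) (b - z)).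
    assert (H5 := Rabs_def2 _ _ Hw). lra.
  - intros z _. set (cz := Rmax a (Rmin b z)).
    assert (Hcz : a <= cz <= b) by (apply clamp_in; lra).
    assert (Hc := cont_deriv _ _ _ _ (Hf cz Hcz)).
    intros eps Heps. destruct (Hc eps Heps) as [d [Hd Hd']].
    exists d; split; [exact Hd|]. intros w [_ Hw].
    unfold g. fold cz. set (cw := Rmax a (Rmin b w)).
    destruct (Req_dec cw cz) as [->|Hne].
    + simpl. unfold Rdist. rewrite Rminus_diag, Rabs_R0. exact Heps.
    + apply Hd'. split.
      * split; [apply clamp_in; lra|auto].
      * simpl. unfold Rdist. eapply Rle_lt_trans; [apply clamp_nonexpansive|].
        exact Hw.
  - exists z. split; [lra|]. split.
    + revert Hz. unfold Rmin, Rmax. repeat destruct Rle_dec;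
      unfold Rabs; repeat destruct Rcase_abs; lra.
    + unfold g in Heq. rewrite !clamp_id in Heq by lra. exact Heq.
Qed.

(** One integration of a pointwise bound, from which Taylor's inequalities below
    follow by iteration. *)
Lemma primitive_bound (f f' : R -> R) (a b x K : R) (k : nat) :
  (forall z, a <= z <= b -> D_in f f' (fun z => a <= z <= b) z) ->
  f x = 0 -> 0 <= K ->
  (forall z, a <= z <= b -> Rabs (f' z) <= K * Rabs (z - x) ^ k) ->
  a <= x <= b ->
  forall y, a <= y <= b -> Rabs (f y) <= K * Rabs (y - x) ^ S k.
Proof.
  intros Hf Hx0 HK Hb Hx y Hy.
  destruct (mean_value_D_in f f' a b x y Hf Hx Hy) as [z [Hz [Hzx Heq]]].
  replace (f y) with (f' z * (y - x)) by lra.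
  rewrite Rabs_mult. simpl. rewrite (Rmult_comm (Rabs (y - x))), <- Rmult_assoc.
  apply Rmult_le_compat_r; [apply Rabs_pos|].
  eapply Rle_trans; [apply Hb; exact Hz|].
  apply Rmult_le_compat_l; [exact HK|].
  apply pow_incr. split; [apply Rabs_pos|exact Hzx].
Qed.

Definition jet (n : nat) (a b B : R) (v : nat -> R -> R) : Prop :=
  (forall k, (k < n)%nat -> forall y, a <= y <= b ->
     D_in (v k) (v (S k)) (fun y => a <= y <= b) y) /\
  (forall k, (k <= n)%nat -> forall y, a <= y <= b -> Rabs (v k y) <= B) /\ 0 <= B.

Lemma jet_shift n a b B v :
  jet (S n) a b B v -> jet n a b B (fun k => v (S k)).
Proof.
  intros [H1 [H2 HB]]. split; [|split; auto].
  - intros k Hk. apply H1. lia.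
  - intros k Hk. apply H2. lia.
Qed.

Lemma D_in_minus_smooth (f f' P P' : R -> R) (D : R -> Prop) (x : R) :
  D_in f f' D x -> (forall y, is_derive P y (P' y)) ->
  D_in (fun y => f y - P y) (fun y => f' y - P' y) D x.
Proof.
  intros Hf HP.
  apply (Dminus D f' P' f P x Hf). apply is_derive_D_in, HP.
Qed.

Lemma taylor1 a b B v : jet 1 a b B v -> forall x y, a <= x <= b -> a <= y <= b ->
  Rabs (v 0%nat y - v 0%nat x) <= B * Rabs (y - x).
Proof.
  intros [Hv [HB B0]] x y Hx Hy. rewrite <- (pow_1 (Rabs (y - x))).
  apply (primitive_bound (fun y => v 0%nat y - v 0%nat x)
           (fun z => v 1%nat z - 0) a b x B 0); auto; try lra.
  - intros z Hz. apply (D_in_minus_smooth (v 0%nat) (v 1%nat) (fun _ => v 0%nat x)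
      (fun _ => 0)); [apply Hv; auto; lia|]. intros w. auto_derive; auto.
  - intros z Hz. rewrite Rminus_0_r, pow_O, Rmult_1_r. auto.
Qed.

Lemma taylor2 a b B v : jet 2 a b B v -> forall x y, a <= x <= b -> a <= y <= b ->
  Rabs (v 0%nat y - (v 0%nat x + v 1%nat x * (y - x))) <= B * Rabs (y - x) ^ 2.
Proof.
  intros Hj x y Hx Hy. assert (Hj' := jet_shift _ _ _ _ _ Hj).
  destruct Hj as [Hv [_ B0]].
  apply (primitive_bound
           (fun y => v 0%nat y - (v 0%nat x + v 1%nat x * (y - x)))
           (fun z => v 1%nat z - v 1%nat x) a b x B 1); auto; try lra.
  - intros z Hz. apply (D_in_minus_smooth (v 0%nat) (v 1%nat) _ 
      (fun _ => v 1%nat x)); [apply Hv; auto; lia|]. intros w. auto_derive; auto; lra.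
  - intros z Hz. rewrite pow_1.
    apply (taylor1 a b B _ Hj'); auto.
Qed.

Lemma taylor3 a b B v : jet 3 a b B v -> forall x y, a <= x <= b -> a <= y <= b ->
  Rabs (v 0%nat y - (v 0%nat x + v 1%nat x * (y - x) + v 2%nat x * (y - x) ^ 2 / 2))
    <= B * Rabs (y - x) ^ 3.
Proof.
  intros Hj x y Hx Hy. assert (Hj' := jet_shift _ _ _ _ _ Hj).
  destruct Hj as [Hv [_ B0]].
  apply (primitive_bound
           (fun y => v 0%nat y
              - (v 0%nat x + v 1%nat x * (y - x) + v 2%nat x * (y - x) ^ 2 / 2))
           (fun z => v 1%nat z - (v 1%nat x + v 2%nat x * (z - x))) a b x B 2);
    auto; try lra.
  - intros z Hz. apply (D_in_minus_smooth (v 0%nat) (v 1%nat) _ 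
      (fun z => v 1%nat x + v 2%nat x * (z - x))); [apply Hv; auto; lia|].
    intros w. auto_derive; auto; field.
  - intros z Hz. apply (taylor2 a b B _ Hj'); auto.
Qed.

Lemma taylor4 a b B v : jet 4 a b B v -> forall x y, a <= x <= b -> a <= y <= b ->
  Rabs (v 0%nat y - (v 0%nat x + v 1%nat x * (y - x) + v 2%nat x * (y - x) ^ 2 / 2
                     + v 3%nat x * (y - x) ^ 3 / 6))
    <= B * Rabs (y - x) ^ 4.
Proof.
  intros Hj x y Hx Hy. assert (Hj' := jet_shift _ _ _ _ _ Hj).
  destruct Hj as [Hv [_ B0]].
  apply (primitive_bound
           (fun y => v 0%nat y
              - (v 0%nat x + v 1%nat x * (y - x) + v 2%nat x * (y - x) ^ 2 / 2
                 + v 3%nat x * (y - x) ^ 3 / 6))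
           (fun z => v 1%nat z - (v 1%nat x + v 2%nat x * (z - x)
                                  + v 3%nat x * (z - x) ^ 2 / 2)) a b x B 3);
    auto; try lra.
  - intros z Hz. apply (D_in_minus_smooth (v 0%nat) (v 1%nat) _ 
      (fun z => v 1%nat x + v 2%nat x * (z - x) + v 3%nat x * (z - x) ^ 2 / 2));
      [apply Hv; auto; lia|].
    intros w. auto_derive; auto; field.
  - intros z Hz. apply (taylor3 a b B _ Hj'); auto.
Qed.

(** * Uniform bounds on the space-time rectangle *)

(** A uniform modulus of continuity for the tolerance 2 bounds the increment of
    [f] along each of finitely many equal steps of the segment that joins the
    corner [(a, 0)] to a given point. *)
Lemma continuous_on_rectangle_bounded (a b T : R) (f : R -> R -> R) :
  a <= b -> 0 <= T ->
  continuous_on (fun z : R * R => a <= fst z <= b /\ 0 <= snd z <= T)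
                (fun z : R * R => f (fst z) (snd z)) ->
  exists B, 0 <= B /\
    forall X t, a <= X <= b -> 0 <= t <= T -> Rabs (f X t) <= B.
Proof.
  intros Hab HT Hc.
  (* The modulus holds up to [2 * d], so that it still applies to a point within [d]
     of one that is within [d] of [(u, v)]. *)
  assert (Hloc : forall u v, exists d : posreal,
    a <= u <= b -> 0 <= v <= T ->
    forall X t, a <= X <= b -> 0 <= t <= T ->
      Rabs (X - u) < 2 * d -> Rabs (t - v) < 2 * d ->
      Rabs (f X t - f u v) < 1).
  { intros u v.
    destruct (excluded_middle_informative
                (a <= u <= b /\ 0 <= v <= T)) as [[Hu Hv]|Hn].
    - destruct (Hc (u, v) (conj Hu Hv) (fun y => Rabs (y - f u v) < 1)) as [d Hd].
      { exists (mkposreal 1 Rlt_0_1). intros y Hy. exact Hy. }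
      assert (Hd2 : 0 < d / 2) by (destruct d as [d0 H0]; simpl; lra).
      exists (mkposreal _ Hd2). intros _ _ X t HX Ht H1 H2. simpl in H1, H2.
      apply (Hd (X, t)); simpl; auto. split; simpl.
      + change (Rabs (X - u) < d). lra.
      + change (Rabs (t - v) < d). lra.
    - exists (mkposreal 1 Rlt_0_1). intros Hu Hv. tauto. }
  set (delta := fun u v => proj1_sig (constructive_indefinite_description _ (Hloc u v))).
  assert (Hdelta : forall u v, a <= u <= b -> 0 <= v <= T ->
    forall X t, a <= X <= b -> 0 <= t <= T ->
      Rabs (X - u) < 2 * delta u v -> Rabs (t - v) < 2 * delta u v ->
      Rabs (f X t - f u v) < 1).
  { intros u v. unfold delta. destruct constructive_indefinite_description; auto. }
  clearbody delta.
  destruct (compactness_value_2d a b 0 T delta) as [d Hd].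
  assert (Hunif : forall X t Y s, a <= X <= b -> 0 <= t <= T ->
     a <= Y <= b -> 0 <= s <= T -> Rabs (Y - X) < d -> Rabs (s - t) < d ->
     Rabs (f Y s - f X t) <= 2).
  { intros X t Y s HX Ht HY Hs H1 H2. apply Rnot_lt_le. intros Hlt.
    apply (Hd X t HX Ht). intros [u [v [Hu [Hv [Hxu [Htv Hdd]]]]]].
    assert (Hp := cond_pos (delta u v)).
    assert (E1 : Rabs (f X t - f u v) < 1) by (apply Hdelta; auto; lra).
    assert (E2 : Rabs (f Y s - f u v) < 1).
    { apply Hdelta; auto.
      - replace (Y - u) with ((Y - X) + (X - u)) by ring.
        eapply Rle_lt_trans; [apply Rabs_triang|]. lra.
      - replace (s - v) with ((s - t) + (t - v)) by ring.
        eapply Rle_lt_trans; [apply Rabs_triang|]. lra. }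
    apply Rabs_def2 in E1. apply Rabs_def2 in E2.
    revert Hlt. unfold Rabs. destruct Rcase_abs; lra. }
  assert (Hd0 := cond_pos d).
  destruct (INR_unbounded ((b - a + T) / d)) as [n Hn].
  assert (Hn0 : 0 < INR n).
  { eapply Rle_lt_trans; [|exact Hn]. apply Rdiv_le_0_compat; lra. }
  assert (Hnd : b - a + T < INR n * d).
  { apply Rmult_lt_compat_r with (r := d) in Hn; [|lra].
    unfold Rdiv in Hn. rewrite Rmult_assoc, Rinv_l, Rmult_1_r in Hn by lra. lra. }
  exists (Rabs (f a 0) + 2 * INR n). split.
  { assert (H := Rabs_pos (f a 0)). lra. }
  intros X t HX Ht.
  assert (Hk : forall k, (k <= n)%nat ->
    Rabs (f (a + INR k * ((X - a) / INR n)) (INR k * (t / INR n)))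
      <= Rabs (f a 0) + 2 * INR k).
  { assert (Hin : forall k, (k <= n)%nat ->
      a <= a + INR k * ((X - a) / INR n) <= b /\ 0 <= INR k * (t / INR n) <= T).
    { intros k Hk. apply le_INR in Hk. assert (Hk0 := pos_INR k).
      assert (Hr : 0 <= INR k / INR n <= 1).
      { split; [apply Rdiv_le_0_compat; lra|].
        apply Rmult_le_reg_r with (INR n); [lra|].
        unfold Rdiv. rewrite Rmult_assoc, Rinv_l by lra. lra. }
      replace (INR k * ((X - a) / INR n)) with (INR k / INR n * (X - a)) by (field; lra).
      replace (INR k * (t / INR n)) with (INR k / INR n * t) by (field; lra).
      split; nra. }
    induction k as [|k IH]; intros Hk.
    - simpl INR. rewrite !Rmult_0_l, Rplus_0_r. lra.
    - assert (Hstep := Hunif _ _ _ _ (proj1 (Hin k ltac:(lia))) (proj2 (Hin k ltac:(lia)))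
        (proj1 (Hin (S k) Hk)) (proj2 (Hin (S k) Hk))).
      specialize (IH ltac:(lia)).
      assert (Hinv : / INR n * (b - a + T) < d).
      { apply Rmult_lt_reg_l with (INR n); [lra|].
        rewrite <- Rmult_assoc, Rinv_r by lra. lra. }
      assert (Hi0 : 0 < / INR n) by (apply Rinv_0_lt_compat; lra).
      rewrite S_INR in *.
      set (A := f (a + (INR k + 1) * ((X - a) / INR n)) ((INR k + 1) * (t / INR n))) in *.
      set (A' := f (a + INR k * ((X - a) / INR n)) (INR k * (t / INR n))) in *.
      assert (HA : Rabs (A - A') <= 2).
      { apply Hstep.
        - replace (_ - _) with (/ INR n * (X - a)) by (field; lra).
          rewrite Rabs_pos_eq; nra.
        - replace (_ - _) with (/ INR n * t) by (field; lra).
          rewrite Rabs_pos_eq; nra. }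
      replace A with ((A - A') + A') by ring.
      eapply Rle_trans; [apply Rabs_triang|]. lra. }
  specialize (Hk n (le_n n)).
  replace (a + INR n * ((X - a) / INR n)) with X in Hk by (field; lra).
  replace (INR n * (t / INR n)) with t in Hk by (field; lra).
  exact Hk.
Qed.

Lemma finite_upper_bound (P : nat -> R -> Prop) (n : nat) :
  (forall i B B', B <= B' -> P i B -> P i B') -> (forall i, exists B, P i B) ->
  exists B, forall i, (i <= n)%nat -> P i B.
Proof.
  intros Hmono Hex. induction n as [|n [B HB]].
  - destruct (Hex 0%nat) as [B HB]. exists B. intros i Hi.
    replace i with 0%nat by lia. exact HB.
  - destruct (Hex (S n)) as [B' HB']. exists (Rmax B B'). intros i Hi.
    destruct (Nat.eq_dec i (S n)) as [->|Hne].
    + apply Hmono with B'; [apply Rmax_r|exact HB'].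
    + apply Hmono with B; [apply Rmax_l|]. apply HB. lia.
Qed.

Lemma smooth_upto_bounded K a b T x : a <= b -> 0 <= T -> smooth_upto K a b T x ->
  exists B, forall j k, (j + k <= K)%nat ->
    forall X t, a <= X <= b -> 0 <= t <= T -> Rabs (x j k X t) <= B.
Proof.
  intros Hab HT Hx.
  destruct (finite_upper_bound (fun j B => forall k, (k <= K)%nat -> (j + k <= K)%nat ->
      forall X t, a <= X <= b -> 0 <= t <= T -> Rabs (x j k X t) <= B) K) as [B HB].
  - intros j B B' HBB H k Hk Hjk X t HX Ht. eapply Rle_trans; [|exact HBB]. auto.
  - intros j.
    destruct (finite_upper_bound (fun k B => (j + k <= K)%nat ->
      forall X t, a <= X <= b -> 0 <= t <= T -> Rabs (x j k X t) <= B) K) as [B HB].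
    + intros k B B' HBB H Hjk X t HX Ht. eapply Rle_trans; [|exact HBB]. auto.
    + intros k. destruct (Nat.le_gt_cases (j + k) K) as [Hle|Hgt].
      * destruct (continuous_on_rectangle_bounded a b T (x j k) Hab HT
                    (proj1 (Hx j k) Hle)) as [B [_ HB]].
        exists B. auto.
      * exists 0. intros H. lia.
    + exists B. intros k Hk. apply HB. exact Hk.
  - exists B. intros j k Hjk. apply HB; lia.
Qed.

Lemma continuous_on_rectangle_positive (a b T : R) (f : R -> R -> R) :
  a <= b -> 0 <= T ->
  continuous_on (fun z : R * R => a <= fst z <= b /\ 0 <= snd z <= T)
                (fun z : R * R => f (fst z) (snd z)) ->
  (forall X t, a <= X <= b -> 0 <= t <= T -> 0 < f X t) ->
  exists beta, 0 < beta /\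
    forall X t, a <= X <= b -> 0 <= t <= T -> beta <= f X t.
Proof.
  intros Hab HT Hc Hpos.
  destruct (continuous_on_rectangle_bounded a b T (fun X t => / f X t) Hab HT)
    as [B [HB0 HB]].
  - intros z Hz. eapply filterlim_comp; [apply (Hc z Hz)|].
    apply continuous_Rinv. apply Rgt_not_eq, Hpos; apply Hz.
  - exists (/ (B + 1)). split; [apply Rinv_0_lt_compat; lra|].
    intros X t HX Ht. assert (H := HB X t HX Ht). assert (Hp := Hpos X t HX Ht).
    rewrite <- (Rinv_inv (f X t)). apply Rinv_le_contravar.
    + apply Rinv_0_lt_compat, Hp.
    + assert (H2 := Rle_abs (/ f X t)). lra.
Qed.

(** * Centred expansions *)

Ltac rabs_bounds := repeat match goal with
  | H : Rabs _ <= _ |- _ => apply Rabs_le_between in H end.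

(** The pair [gp, gm] of values at two points symmetric about a node, at distance
    [eta], behaves to second order like [g0 + eta * g1, g0 - eta * g1].  Only the
    mean and the divided difference of the pair enter, so odd and even terms never
    have to be expanded separately. *)
Definition centred (B eta gp gm g0 g1 : R) : Prop :=
  0 < eta <= B /\
  Rabs ((gp + gm) / 2 - g0) <= B * eta ^ 2 /\
  Rabs ((gp - gm) / (2 * eta) - g1) <= B * eta ^ 2 /\
  Rabs g0 <= B /\ Rabs g1 <= B.

Lemma Rabs_mult_le x y p q : Rabs x <= p -> Rabs y <= q -> Rabs (x * y) <= p * q.
Proof.
  intros Hx Hy. rewrite Rabs_mult. apply Rmult_le_compat; auto; apply Rabs_pos.
Qed.

Lemma Rabs_plus_le x y p q : Rabs x <= p -> Rabs y <= q -> Rabs (x + y) <= p + q.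
Proof. intros Hx Hy. eapply Rle_trans; [apply Rabs_triang|]. lra. Qed.

Lemma Rabs_opp_le x p : Rabs x <= p -> Rabs (- x) <= p.
Proof. rewrite Rabs_Ropp. auto. Qed.

Lemma centred_weaken B B' eta gp gm g0 g1 :
  B <= B' -> centred B eta gp gm g0 g1 -> centred B' eta gp gm g0 g1.
Proof.
  intros HB [He [H1 [H2 [H3 H4]]]]. assert (H5 := pow2_ge_0 eta).
  repeat split; try lra; eapply Rle_trans; eauto; nra.
Qed.

(** The pair is parametrised as [A + eta * D], [A - eta * D]; products and
    inverses then act on [(A, D)] up to [eta ^ 2]. *)
Lemma centred_parts B eta gp gm g0 g1 :
  centred B eta gp gm g0 g1 ->
  exists A D, gp = A + eta * D /\ gm = A - eta * D /\
    Rabs (A - g0) <= B * eta ^ 2 /\ Rabs (D - g1) <= B * eta ^ 2 /\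
    Rabs A <= B + B ^ 3 /\ Rabs D <= B + B ^ 3.
Proof.
  intros [He [H1 [H2 [H3 H4]]]].
  exists ((gp + gm) / 2), ((gp - gm) / (2 * eta)).
  assert (Hee : B * eta ^ 2 <= B ^ 3).
  { replace (B ^ 3) with (B * B ^ 2) by ring.
    apply Rmult_le_compat_l; [lra|]. apply pow_incr; lra. }
  repeat split; auto; try (field; lra).
  - replace ((gp + gm) / 2) with (g0 + ((gp + gm) / 2 - g0)) by ring.
    apply Rabs_plus_le; lra.
  - replace ((gp - gm) / (2 * eta)) with (g1 + ((gp - gm) / (2 * eta) - g1)) by ring.
    apply Rabs_plus_le; lra.
Qed.

(** In [(A + eta * D) * (A' + eta * D')] the products [A * A'] and [A * D' + D * A']
    appear exactly, up to [eta ^ 2 * D * D'] in the mean. *)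
Lemma centred_mult B : exists B', forall eta fp fm f0 f1 gp gm g0 g1,
  centred B eta fp fm f0 f1 -> centred B eta gp gm g0 g1 ->
  centred B' eta (fp * gp) (fm * gm) (f0 * g0) (f0 * g1 + f1 * g0).
Proof.
  set (B2 := B + B ^ 3).
  exists (2 * (B * B2 + B * B + B2 * B2) + B).
  intros eta fp fm f0 f1 gp gm g0 g1 Hf Hg.
  destruct (centred_parts _ _ _ _ _ _ Hf) as [A [D [-> [-> [HA [HD [HA2 HD2]]]]]]].
  destruct (centred_parts _ _ _ _ _ _ Hg) as [A' [D' [-> [-> [HA' [HD' [HA2' HD2']]]]]]].
  destruct Hf as [He [_ [_ [Hf0 Hf1]]]], Hg as [_ [_ [_ [Hg0 Hg1]]]].
  fold B2 in HA2, HD2, HA2', HD2'.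
  assert (HB : 0 < B) by lra.
  assert (HB2 : 0 < B2) by (unfold B2; assert (0 < B ^ 3) by (apply pow_lt; lra); lra).
  assert (He2 := pow2_ge_0 eta).
  assert (P1 : 0 < B * B2) by nra. assert (P2 : 0 < B * B) by nra.
  assert (P3 : 0 < B2 * B2) by nra.
  split; [nra|]. split; [|split; [|split]].
  - replace (_ - f0 * g0) with
      ((A - f0) * A' + f0 * (A' - g0) + eta ^ 2 * (D * D')) by field.
    eapply Rle_trans.
    { apply Rabs_plus_le; [apply Rabs_plus_le|].
      - apply Rabs_mult_le; eassumption.
      - apply Rabs_mult_le; eassumption.
      - apply Rabs_mult_le; [apply Req_le, Rabs_pos_eq; lra|].
        apply Rabs_mult_le; eassumption. }
    nra.
  - replace (_ - (f0 * g1 + f1 * g0)) with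
      (((A - f0) * D' + f0 * (D' - g1)) + ((D - f1) * A' + f1 * (A' - g0)))
      by (field; lra).
    eapply Rle_trans.
    { apply Rabs_plus_le; apply Rabs_plus_le; apply Rabs_mult_le; eassumption. }
    nra.
  - eapply Rle_trans; [apply Rabs_mult_le; eassumption|]. nra.
  - eapply Rle_trans; [apply Rabs_plus_le; apply Rabs_mult_le; eassumption|]. nra.
Qed.

(** [/ (A + eta * D) = (A - eta * D) / (A ^ 2 - eta ^ 2 * D ^ 2)], whose denominator is
    [g0 ^ 2] up to [O(eta ^ 2)]. *)
Lemma centred_inv B kappa : 0 < kappa -> exists B', forall eta gp gm g0 g1,
  centred B eta gp gm g0 g1 -> kappa <= gp -> kappa <= gm -> kappa <= g0 ->
  centred B' eta (/ gp) (/ gm) (/ g0) (- g1 / g0 ^ 2).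
Proof.
  intros Hk. set (B2 := B + B ^ 3). set (E := B * (B2 + B) + B2 * B2).
  exists ((B2 * E) * / kappa ^ 4 + B * / kappa ^ 2 + B + / kappa).
  intros eta gp gm g0 g1 Hg Kp Km K0.
  destruct (centred_parts _ _ _ _ _ _ Hg) as [A [D [-> [-> [HA [HD [HA2 HD2]]]]]]].
  destruct Hg as [He [_ [_ [Hg0 Hg1]]]].
  fold B2 in HA2, HD2.
  assert (HB : 0 < B) by lra.
  assert (HB2 : 0 < B2) by (unfold B2; assert (0 < B ^ 3) by (apply pow_lt; lra); lra).
  assert (HE : 0 < E) by (unfold E; nra).
  assert (He2 := pow2_ge_0 eta).
  assert (Hi1 : 0 < / kappa) by (apply Rinv_0_lt_compat; lra).
  assert (Hi2 : 0 < / kappa ^ 2) by (apply Rinv_0_lt_compat, pow_lt; lra).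
  assert (Hi4 : 0 < / kappa ^ 4) by (apply Rinv_0_lt_compat, pow_lt; lra).
  set (w := / ((A + eta * D) * (A - eta * D))).
  assert (Hw0 : 0 < / g0 ^ 2 <= / kappa ^ 2).
  { split; [apply Rinv_0_lt_compat, pow_lt; lra|].
    apply Rinv_le_contravar; [apply pow_lt; lra|]. apply pow_incr; lra. }
  assert (Hwd : Rabs (w - / g0 ^ 2) <= eta ^ 2 * E * / kappa ^ 4).
  { replace (w - / g0 ^ 2) with
      ((- ((A - g0) * (A + g0)) + eta ^ 2 * (D * D))
       * / ((A + eta * D) * (A - eta * D) * g0 ^ 2))
      by (unfold w; field; repeat split; lra).
    apply Rabs_mult_le.
    - eapply Rle_trans.
      { apply Rabs_plus_le.
        - apply Rabs_opp_le. apply Rabs_mult_le; [eassumption|].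
          apply Rabs_plus_le; eassumption.
        - apply Rabs_mult_le; [apply Req_le, Rabs_pos_eq; lra|].
          apply Rabs_mult_le; eassumption. }
      unfold E. lra.
    - assert (Hpm : kappa ^ 2 <= (A + eta * D) * (A - eta * D)).
      { replace (kappa ^ 2) with (kappa * kappa) by ring.
        apply Rmult_le_compat; lra. }
      assert (Hk2 : 0 < kappa ^ 2) by (apply pow_lt; lra).
      assert (Hg2 : kappa ^ 2 <= g0 ^ 2) by (apply pow_incr; lra).
      rewrite Rabs_pos_eq.
      + apply Rinv_le_contravar; [apply pow_lt; lra|].
        replace (kappa ^ 4) with (kappa ^ 2 * kappa ^ 2) by ring.
        apply Rmult_le_compat; lra.
      + apply Rlt_le, Rinv_0_lt_compat. apply Rmult_lt_0_compat; lra. }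
  assert (Q1 : 0 < (B2 * E) * / kappa ^ 4) by (apply Rmult_lt_0_compat; nra).
  assert (Q2 : 0 < B * / kappa ^ 2) by nra.
  split; [lra|]. split; [|split; [|split]].
  - replace (_ - / g0) with (A * (w - / g0 ^ 2) + (A - g0) * / g0 ^ 2)
      by (unfold w; field; repeat split; lra).
    eapply Rle_trans.
    { apply Rabs_plus_le; apply Rabs_mult_le; try eassumption.
      apply Req_le, Rabs_pos_eq; lra. }
    assert (B * eta ^ 2 * / g0 ^ 2 <= B * eta ^ 2 * / kappa ^ 2).
    { apply Rmult_le_compat_l; [nra|lra]. }
    nra.
  - replace (_ - - g1 / g0 ^ 2) with (- (D * (w - / g0 ^ 2) + (D - g1) * / g0 ^ 2))
      by (unfold w; field; repeat split; lra).
    eapply Rle_trans.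
    { apply Rabs_opp_le. apply Rabs_plus_le; apply Rabs_mult_le; try eassumption.
      apply Req_le, Rabs_pos_eq; lra. }
    assert (B * eta ^ 2 * / g0 ^ 2 <= B * eta ^ 2 * / kappa ^ 2).
    { apply Rmult_le_compat_l; [nra|lra]. }
    nra.
  - rewrite Rabs_pos_eq by (apply Rlt_le, Rinv_0_lt_compat; lra).
    assert (/ g0 <= / kappa) by (apply Rinv_le_contravar; lra). lra.
  - unfold Rdiv. eapply Rle_trans.
    { apply Rabs_mult_le; [apply Rabs_opp_le; eassumption|].
      apply Req_le, Rabs_pos_eq; lra. }
    assert (B * / g0 ^ 2 <= B * / kappa ^ 2) by (apply Rmult_le_compat_l; lra). lra.
Qed.

Lemma centred_jet B : exists B', forall a b v X eta,
  jet 3 a b B v -> 0 < eta <= B -> a <= X - eta -> X + eta <= b ->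
  centred B' eta (v 0%nat (X + eta)) (v 0%nat (X - eta)) (v 0%nat X) (v 1%nat X).
Proof.
  exists (B + B * B).
  intros a b v X eta Hj He Ha Hb.
  assert (Tp := taylor3 _ _ _ _ Hj X (X + eta) ltac:(lra) ltac:(lra)).
  assert (Tm := taylor3 _ _ _ _ Hj X (X - eta) ltac:(lra) ltac:(lra)).
  destruct Hj as [_ [Hv _]].
  replace (X + eta - X) with eta in Tp by ring.
  replace (X - eta - X) with (- eta) in Tm by ring.
  rewrite Rabs_Ropp in Tm. rewrite (Rabs_pos_eq eta) in Tp, Tm by lra.
  assert (V0 := Hv 0%nat ltac:(lia) X ltac:(lra)).
  assert (V1 := Hv 1%nat ltac:(lia) X ltac:(lra)).
  assert (V2 := Hv 2%nat ltac:(lia) X ltac:(lra)).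
  set (v0 := v 0%nat X) in *. set (v1 := v 1%nat X) in *. set (v2 := v 2%nat X) in *.
  set (rp := v 0%nat (X + eta) - _) in Tp. set (rm := v 0%nat (X - eta) - _) in Tm.
  replace (v 0%nat (X + eta)) with (rp + (v0 + v1 * eta + v2 * eta ^ 2 / 2))
    by (unfold rp; ring).
  replace (v 0%nat (X - eta)) with (rm + (v0 + v1 * - eta + v2 * (- eta) ^ 2 / 2))
    by (unfold rm; ring).
  assert (He3 : B * eta ^ 3 <= B * B * eta ^ 2).
  { replace (B * eta ^ 3) with (B * eta ^ 2 * eta) by ring.
    replace (B * B * eta ^ 2) with (B * eta ^ 2 * B) by ring.
    apply Rmult_le_compat_l; nra. }
  assert (He2 : 0 < eta ^ 2) by (apply pow_lt; lra).
  split; [nra|]. split; [|split; [|split; nra]].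
  - replace (_ - v0) with (eta ^ 2 * (v2 / 2) + (rp + rm) / 2) by field.
    assert (V2e : Rabs (eta ^ 2 * v2) <= eta ^ 2 * B).
    { apply Rabs_mult_le; [apply Req_le, Rabs_pos_eq; lra|auto]. }
    rabs_bounds. apply Rabs_le. lra.
  - replace (_ - v1) with ((rp - rm) / 2 / eta) by (field; lra).
    unfold Rdiv at 1. rewrite Rabs_mult, (Rabs_pos_eq (/ eta))
      by (apply Rlt_le, Rinv_0_lt_compat; lra).
    apply Rmult_le_reg_r with eta; [lra|].
    rewrite Rmult_assoc, Rinv_l, Rmult_1_r by lra.
    assert (0 <= B * B * eta ^ 2 * eta) by (assert (0 < B * B) by nra; nra).
    rabs_bounds. apply Rabs_le. nra.
Qed.

(** Seen from the midpoint of its own cell, a difference quotient has the error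
    [eta ^ 2 * v''' / 6], whose divided difference would not be controlled without a
    further expansion.  Seen from the common node, the mean and the divided difference
    of the two quotients are the central first and second differences of [v]. *)
Lemma centred_difference_quotient B : exists B', forall a b v X eta,
  jet 4 a b B v -> 0 < eta <= B -> a <= X - 2 * eta -> X + 2 * eta <= b ->
  centred B' eta ((v 0%nat (X + 2 * eta) - v 0%nat X) / (2 * eta))
    ((v 0%nat X - v 0%nat (X - 2 * eta)) / (2 * eta)) (v 1%nat X) (v 2%nat X).
Proof.
  exists (8 * (B + B * B)).
  intros a b v X eta Hj He Ha Hb.
  assert (Tp := taylor4 _ _ _ _ Hj X (X + 2 * eta) ltac:(lra) ltac:(lra)).
  assert (Tm := taylor4 _ _ _ _ Hj X (X - 2 * eta) ltac:(lra) ltac:(lra)).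
  destruct Hj as [_ [Hv _]].
  replace (X + 2 * eta - X) with (2 * eta) in Tp by ring.
  replace (X - 2 * eta - X) with (- (2 * eta)) in Tm by ring.
  rewrite Rabs_Ropp in Tm. rewrite (Rabs_pos_eq (2 * eta)) in Tp, Tm by lra.
  assert (V1 := Hv 1%nat ltac:(lia) X ltac:(lra)).
  assert (V2 := Hv 2%nat ltac:(lia) X ltac:(lra)).
  assert (V3 := Hv 3%nat ltac:(lia) X ltac:(lra)).
  set (v0 := v 0%nat X) in *. set (v1 := v 1%nat X) in *. set (v2 := v 2%nat X) in *.
  set (v3 := v 3%nat X) in *.
  set (rp := v 0%nat (X + 2 * eta) - _) in Tp.
  set (rm := v 0%nat (X - 2 * eta) - _) in Tm.
  replace (v 0%nat (X + 2 * eta)) with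
    (rp + (v0 + v1 * (2 * eta) + v2 * (2 * eta) ^ 2 / 2 + v3 * (2 * eta) ^ 3 / 6))
    by (unfold rp; ring).
  replace (v 0%nat (X - 2 * eta)) with
    (rm + (v0 + v1 * - (2 * eta) + v2 * (- (2 * eta)) ^ 2 / 2
           + v3 * (- (2 * eta)) ^ 3 / 6))
    by (unfold rm; ring).
  replace (B * (2 * eta) ^ 4) with (eta * (16 * (B * eta ^ 3))) in Tp, Tm by ring.
  assert (He3 : B * eta ^ 3 <= B * B * eta ^ 2).
  { replace (B * eta ^ 3) with (B * eta ^ 2 * eta) by ring.
    replace (B * B * eta ^ 2) with (B * eta ^ 2 * B) by ring.
    apply Rmult_le_compat_l; nra. }
  assert (He2 : 0 < eta ^ 2) by (apply pow_lt; lra).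
  assert (Hdiv : forall r, Rabs r <= eta * (16 * (B * eta ^ 3)) ->
    Rabs (r / eta) <= 16 * (B * eta ^ 3)).
  { intros r Hr. unfold Rdiv. rewrite Rabs_mult, (Rabs_pos_eq (/ eta))
      by (apply Rlt_le, Rinv_0_lt_compat; lra).
    apply Rmult_le_reg_r with eta; [lra|].
    rewrite Rmult_assoc, Rinv_l, Rmult_1_r by lra. lra. }
  apply Hdiv in Tp. apply Hdiv in Tm.
  split; [nra|]. split; [|split; [|split; nra]].
  - replace (_ - v1) with (eta ^ 2 * v3 * (2 / 3) + (rp / eta - rm / eta) / 4)
      by (field; lra).
    assert (V2e : Rabs (eta ^ 2 * v3) <= eta ^ 2 * B).
    { apply Rabs_mult_le; [apply Req_le, Rabs_pos_eq; lra|auto]. }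
    rabs_bounds. apply Rabs_le. nra.
  - replace (_ - v2) with ((rp / eta + rm / eta) / (4 * eta)) by (field; lra).
    unfold Rdiv at 1. rewrite Rabs_mult, (Rabs_pos_eq (/ (4 * eta)))
      by (apply Rlt_le, Rinv_0_lt_compat; lra).
    apply Rmult_le_reg_r with (4 * eta); [lra|].
    rewrite Rmult_assoc, Rinv_l, Rmult_1_r by lra.
    apply Rle_trans with (2 * (16 * (B * eta ^ 3))).
    + rabs_bounds. apply Rabs_le. lra.
    + assert (0 <= B * B * eta ^ 2 * eta) by (assert (0 < B * B) by nra; nra). nra.
Qed.

(** * Real powers, fluxes and mobilities *)

Lemma Rpower_pos x e : 0 < Rpower x e.
Proof. apply exp_pos. Qed.

Lemma Rpower_Rinv x e : 0 < x -> Rpower (/ x) e = / Rpower x e.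
Proof.
  intros Hx. unfold Rpower. rewrite ln_Rinv by exact Hx.
  rewrite <- exp_Ropp. f_equal. ring.
Qed.

Lemma Rpower_bounds lo hi e : 0 < lo -> exists K k, 0 < k /\
  forall y, lo <= y <= hi -> k <= Rpower y e /\ Rabs (Rpower y e) <= K.
Proof.
  intros Hlo.
  destruct (Rle_dec lo hi) as [Hlh|Hn].
  2: { exists 1, 1. split; [lra|]. intros y Hy. lra. }
  exists (Rmax (Rpower lo e) (Rpower hi e)), (Rmin (Rpower lo e) (Rpower hi e)).
  split. { apply Rmin_case; apply Rpower_pos. }
  intros y Hy. rewrite Rabs_pos_eq by (apply Rlt_le, Rpower_pos).
  destruct (Rle_dec 0 e) as [He|He].
  - assert (H1 : Rpower lo e <= Rpower y e) by (apply Rle_Rpower_l; lra).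
    assert (H2 : Rpower y e <= Rpower hi e) by (apply Rle_Rpower_l; lra).
    split.
    + eapply Rle_trans; [apply Rmin_l|]; lra.
    + eapply Rle_trans; [|apply Rmax_r]; lra.
  - assert (Hd : forall y z, 0 < y <= z -> Rpower z e <= Rpower y e).
    { intros w z Hw. replace e with (- - e) by ring. rewrite !(Rpower_Ropp _ (- e)).
      apply Rinv_le_contravar; [apply Rpower_pos|]. apply Rle_Rpower_l; lra. }
    assert (H1 := Hd lo y ltac:(lra)). assert (H2 := Hd y hi ltac:(lra)).
    split.
    + eapply Rle_trans; [apply Rmin_r|]; lra.
    + eapply Rle_trans; [|apply Rmax_l]; lra.
Qed.

Lemma Rpower_lipschitz lo hi e : 0 < lo -> exists L, 0 <= L /\
  forall y z, lo <= y <= hi -> lo <= z <= hi ->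
    Rabs (Rpower y e - Rpower z e) <= L * Rabs (y - z).
Proof.
  intros Hlo. destruct (Rpower_bounds lo hi (e - 1) Hlo) as [K [k [_ HK]]].
  exists (Rabs e * Rabs K). split; [apply Rmult_le_pos; apply Rabs_pos|].
  intros y z Hy Hz.
  destruct (mean_value_D_in (fun y => Rpower y e) (fun y => e * Rpower y (e - 1))
              lo hi z y) as [w [Hw [_ ->]]]; auto.
  - intros w Hw. apply is_derive_D_in, is_derive_Reals, derivable_pt_lim_power. lra.
  - rewrite Rabs_mult. apply Rmult_le_compat_r; [apply Rabs_pos|].
    rewrite Rabs_mult. apply Rmult_le_compat_l; [apply Rabs_pos|].
    eapply Rle_trans; [apply HK; exact Hw|]. apply Rle_abs.
Qed.

Lemma is_derive_Rmult (f g : R -> R) (x df dg : R) :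
  is_derive f x df -> is_derive g x dg ->
  is_derive (fun y => f y * g y) x (df * g x + f x * dg).
Proof.
  intros Hf Hg. exact (is_derive_mult f g x df dg Hf Hg Rmult_comm).
Qed.

Lemma is_derive_Rpower (g : R -> R) (x dg e : R) :
  0 < g x -> is_derive g x dg ->
  is_derive (fun y => Rpower (g y) e) x (e * Rpower (g x) (e - 1) * dg).
Proof.
  intros Hg Hd. rewrite (Rmult_comm _ dg).
  apply (is_derive_comp (fun z => Rpower z e) g); [|exact Hd].
  apply is_derive_Reals, derivable_pt_lim_power, Hg.
Qed.

(** In terms of [y = D / f], both schemes read
    [mobility * (velocity) = difference of fluxes]. *)
Definition flux (c : traj_case) (y : R) : R :=
  match c with Case1 => - / y | Case2 => y end.

Definition mobility (c : traj_case) (m f D : R) : R :=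
  f / m * Rpower (D / f) (match c with Case1 => m - 1 | Case2 => m + 1 end).

Lemma mobility_Case1 m f D : 0 < m -> 0 < f -> 0 < D ->
  f / (m * Rpower (f / D) (m - 1)) = mobility Case1 m f D.
Proof.
  intros Hm Hf HD. unfold mobility.
  replace (f / D) with (/ (D / f)) by (field; lra).
  rewrite Rpower_Rinv by (apply Rdiv_lt_0_compat; lra).
  assert (H := Rpower_pos (D / f) (m - 1)). field. lra.
Qed.

Lemma mobility_Case2 m f D : 0 < m -> 0 < f -> 0 < D ->
  Rpower D (m + 1) / (m * Rpower f m) = mobility Case2 m f D.
Proof.
  intros Hm Hf HD. unfold mobility. change (D / f) with (D * / f).
  rewrite <- Rpower_mult_distr by (auto using Rinv_0_lt_compat).
  rewrite (Rpower_Rinv f) by lra.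
  rewrite (Rpower_plus m 1 f), Rpower_1 by lra.
  assert (H := Rpower_pos f m). field. lra.
Qed.

(** Both trajectory equations are the same first-order equation for the density
    [q = f0 / d_X x]: Case 1 gives [d_X q] directly, Case 2 gives the derivative of
    [/ q]. *)
Lemma trajectory_equation_density c m f0 x X t :
  0 < m -> 0 < f0 X -> 0 < x 1%nat 0%nat X t ->
  trajectory_equation c m f0 x X t ->
  is_derive (fun Y => f0 Y / x 1%nat 0%nat Y t) X
    (- (x 1%nat 0%nat X t * x 0%nat 1%nat X t / m)
       * Rpower (f0 X / x 1%nat 0%nat X t) (2 - m)).
Proof.
  intros Hm Hf HD. set (D := x 1%nat 0%nat X t) in *.
  assert (HfD : 0 < f0 X / D) by (apply Rdiv_lt_0_compat; lra).
  destruct c; simpl; intros [Hex Heq]; fold D in Heq.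
  - apply Derive_correct in Hex.
    replace (- _ * _) with (Derive (fun Y => f0 Y / x 1%nat 0%nat Y t) X);
      [exact Hex|].
    rewrite <- (Ropp_involutive (Derive _ _)), <- Heq.
    replace (2 - m) with (1 + - (m - 1)) by ring.
    rewrite Rpower_plus, Rpower_Ropp, Rpower_1 by exact HfD.
    assert (H := Rpower_pos (f0 X / D) (m - 1)). field. lra.
  - apply Derive_correct in Hex. rewrite <- Heq in Hex.
    apply (is_derive_ext (fun Y => / (x 1%nat 0%nat Y t / f0 Y))).
    { intros Y. unfold Rdiv. rewrite Rinv_mult, Rinv_inv. apply Rmult_comm. }
    evar_last.
    { apply is_derive_inv; [exact Hex|]. fold D.
      apply Rgt_not_eq, Rdiv_lt_0_compat; lra. }
    cbv beta. fold D. rewrite (mobility_Case2 m (f0 X) D Hm Hf HD). unfold mobility.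
    replace (D / f0 X) with (/ (f0 X / D)) by (field; lra).
    rewrite Rpower_Rinv by exact HfD.
    replace (m + 1) with (- (2 - m) + 3) by ring.
    rewrite Rpower_plus, Rpower_Ropp.
    assert (E3 : Rpower (f0 X / D) 3 = (f0 X / D) ^ 3).
    { rewrite <- (Rpower_pow 3) by exact HfD. f_equal. simpl. ring. }
    rewrite E3.
    assert (H := Rpower_pos (f0 X / D) (2 - m)).
    field. repeat split; lra.
Qed.

(** * Sums over a grid *)

Definition ssum (f : nat -> R) (n : nat) : R := sum_n_m f 1 n.

Lemma ssum_0 f : ssum f 0 = 0.
Proof. unfold ssum. rewrite sum_n_m_zero by lia. reflexivity. Qed.

Lemma ssum_S f n : ssum f (S n) = ssum f n + f (S n).
Proof. unfold ssum. rewrite sum_n_Sm by lia. reflexivity. Qed.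

Lemma ssum_le f g n :
  (forall i, (1 <= i <= n)%nat -> f i <= g i) -> ssum f n <= ssum g n.
Proof.
  induction n as [|n IH]; intros H; [rewrite !ssum_0; lra|].
  rewrite !ssum_S. apply Rplus_le_compat; [apply IH; intros i Hi|]; apply H; lia.
Qed.

Lemma ssum_ext f g n :
  (forall i, (1 <= i <= n)%nat -> f i = g i) -> ssum f n = ssum g n.
Proof. apply sum_n_m_ext_loc. Qed.

Lemma ssum_nonneg f n :
  (forall i, (1 <= i <= n)%nat -> 0 <= f i) -> 0 <= ssum f n.
Proof.
  induction n as [|n IH]; intros H; [rewrite ssum_0; lra|].
  rewrite ssum_S. apply Rplus_le_le_0_compat; [apply IH; intros i Hi|]; apply H; lia.
Qed.

Lemma ssum_plus f g n : ssum (fun i => f i + g i) n = ssum f n + ssum g n.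
Proof. induction n as [|n IH]; [rewrite !ssum_0|rewrite !ssum_S, IH]; ring. Qed.

Lemma ssum_scal k f n : ssum (fun i => k * f i) n = k * ssum f n.
Proof. induction n as [|n IH]; [rewrite !ssum_0|rewrite !ssum_S, IH]; ring. Qed.

Lemma ssum_const k n : ssum (fun _ => k) n = INR n * k.
Proof.
  induction n as [|n IH]; [rewrite ssum_0; simpl; ring|rewrite ssum_S, IH, S_INR; ring].
Qed.

Lemma ssum_term_le f n i : (forall i, (1 <= i <= n)%nat -> 0 <= f i) ->
  (1 <= i <= n)%nat -> f i <= ssum f n.
Proof.
  induction n as [|n IH]; intros H Hi; [lia|]. rewrite ssum_S.
  destruct (Nat.eq_dec i (S n)) as [->|Hne].
  - assert (0 <= ssum f n) by (apply ssum_nonneg; intros j Hj; apply H; lia). lra.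
  - assert (0 <= f (S n)) by (apply H; lia).
    assert (f i <= ssum f n) by (apply IH; [intros j Hj; apply H; lia|lia]). lra.
Qed.

Lemma ssum_shift_le f n : (forall i, (1 <= i <= n)%nat -> 0 <= f i) ->
  ssum (fun i => f (i + 1)%nat) (n - 1) <= ssum f n.
Proof.
  intros H. destruct n as [|n]; [rewrite !ssum_0; lra|].
  replace (S n - 1)%nat with n by lia.
  assert (E : f 1%nat + ssum (fun i => f (i + 1)%nat) n = ssum f (S n)).
  { clear H. induction n as [|n IH].
    - rewrite ssum_S, !ssum_0. ring.
    - rewrite ssum_S, (ssum_S f (S n)), <- IH.
      replace (S n + 1)%nat with (S (S n)) by lia. ring. }
  assert (0 <= f 1%nat) by (apply H; lia). lra.
Qed.

Lemma ssum_pred_le f n : (forall i, (1 <= i <= n)%nat -> 0 <= f i) ->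
  ssum f (n - 1) <= ssum f n.
Proof.
  intros H. destruct n as [|n]; [apply Rle_refl|]. replace (S n - 1)%nat with n by lia.
  rewrite ssum_S. assert (0 <= f (S n)) by (apply H; lia). lra.
Qed.

Lemma summation_by_parts (psi delta : nat -> R) M : (1 <= M)%nat ->
  ssum (fun j => psi j * (delta j - delta (j - 1)%nat)) M
  = psi M * delta M - psi 1%nat * delta 0%nat
    - ssum (fun i => (psi (i + 1)%nat - psi i) * delta i) (M - 1).
Proof.
  destruct M as [|M]; [lia|]. intros _.
  replace (S M - 1)%nat with M by lia.
  induction M as [|M IH].
  - rewrite ssum_S, !ssum_0. simpl (1 - 1)%nat. ring.
  - rewrite ssum_S, IH, (ssum_S _ M).
    replace (S (S M) - 1)%nat with (S M) by lia.
    replace (S M + 1)%nat with (S (S M)) by lia. ring.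
Qed.

Lemma ssum_cauchy_one f n : (ssum f n) ^ 2 <= INR n * ssum (fun i => f i ^ 2) n.
Proof.
  induction n as [|n IH]; [rewrite !ssum_0; simpl; lra|].
  rewrite !ssum_S, S_INR.
  set (s := ssum f n) in *. set (q := ssum (fun i => f i ^ 2) n) in *.
  set (y := f (S n)).
  assert (Hq : 0 <= q) by (apply ssum_nonneg; intros; apply pow2_ge_0).
  assert (Hn := pos_INR n).
  destruct (Req_dec (INR n) 0) as [E|E].
  - rewrite E in *. assert (s = 0) by nra. subst s. nra.
  - assert (H2 : 2 * (s * y) <= q + INR n * y ^ 2).
    { assert (Hn' : 0 < INR n) by lra.
      apply Rmult_le_reg_l with (INR n); [lra|].
      assert (H := pow2_ge_0 (s - INR n * y)). nra. }
    nra.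
Qed.

Lemma ssum_le_ssum f n p : (n <= p)%nat -> (forall i, 0 <= f i) -> ssum f n <= ssum f p.
Proof.
  intros Hnp Hf. induction Hnp as [|p Hnp IH]; [lra|].
  rewrite ssum_S. specialize (Hf (S p)). lra.
Qed.

(** * The discrete maximum principle *)

Lemma nat_argmax (g : nat -> R) M : (1 <= M)%nat ->
  exists j, (1 <= j <= M)%nat /\ forall k, (1 <= k <= M)%nat -> g k <= g j.
Proof.
  destruct M as [|M]; [lia|]. intros _. induction M as [|M [j [Hj Hmax]]].
  - exists 1%nat. split; [lia|]. intros k Hk. replace k with 1%nat by lia. lra.
  - destruct (Rle_dec (g (S (S M))) (g j)) as [Hle|Hgt].
    + exists j. split; [lia|]. intros k Hk.
      destruct (Nat.eq_dec k (S (S M))) as [->|Hne]; [exact Hle|]. apply Hmax; lia.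
    + exists (S (S M)). split; [lia|]. intros k Hk.
      destruct (Nat.eq_dec k (S (S M))) as [->|Hne]; [lra|].
      apply Rle_trans with (g j); [apply Hmax; lia|lra].
Qed.

Lemma flux_le c y z : 0 < y -> y <= z -> flux c y <= flux c z.
Proof.
  intros Hy Hyz. destruct c; simpl; [|lra].
  apply Ropp_le_contravar, Rinv_le_contravar; lra.
Qed.

Lemma flux_gap c hi y z : 0 < y <= hi -> 0 < z <= hi ->
  Rabs (y - z) <= (1 + hi ^ 2) * Rabs (flux c y - flux c z).
Proof.
  intros Hy Hz. assert (H2 := pow2_ge_0 hi). destruct c; cbn [flux].
  - replace (y - z) with ((y * z) * (- / y - - / z)) by (field; lra).
    rewrite Rabs_mult. apply Rmult_le_compat_r; [apply Rabs_pos|].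
    rewrite Rabs_pos_eq by nra. nra.
  - assert (X := Rabs_pos (y - z)). nra.
Qed.

Definition implicit_step (c : traj_case) (M : nat) (h tau : R)
    (A phi w w' : nat -> R) : Prop :=
  (forall i, (1 <= i <= M - 1)%nat ->
     A i * ((w' i - w i) / tau)
     = (flux c (D_h h w' (i + 1) / phi (i + 1)%nat) - flux c (D_h h w' i / phi i)) / h)
  /\ w' 0%nat = w 0%nat /\ w' M = w M.

(** Where the new density [phi / D_h w'] is maximal, the flux differences on both sides
    show that the neighbouring nodes moved apart, so that the density was at least as
    large before the step; similarly for a minimum. *)
Lemma implicit_step_maximum_principle c M h tau A phi w w' lo hi :
  (1 <= M)%nat -> 0 < h -> 0 < tau ->
  (forall i, (1 <= i <= M - 1)%nat -> 0 < A i) ->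
  (forall j, (1 <= j <= M)%nat -> 0 < phi j) ->
  (forall j, (1 <= j <= M)%nat -> 0 < D_h h w' j) ->
  implicit_step c M h tau A phi w w' ->
  (forall j, (1 <= j <= M)%nat -> lo <= D_h h w j / phi j <= hi) ->
  forall j, (1 <= j <= M)%nat -> lo <= D_h h w' j / phi j <= hi.
Proof.
  intros HM Hh Ht HA Hphi HD [Hs [H0 HMe]] Hold.
  set (y := fun j => D_h h w' j / phi j).
  assert (Hy : forall j, (1 <= j <= M)%nat -> 0 < y j).
  { intros j Hj. apply Rdiv_lt_0_compat; auto. }
  assert (Hsign : forall i, (1 <= i <= M - 1)%nat ->
     (y i <= y (i + 1)%nat -> w i <= w' i) /\ (y (i + 1)%nat <= y i -> w' i <= w i)).
  { intros i Hi. specialize (Hs i Hi). fold (y i) (y (i + 1)%nat) in Hs.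
    assert (Ha := HA i Hi).
    assert (E : w' i - w i
                = (flux c (y (i + 1)%nat) - flux c (y i)) * (tau / (h * A i))).
    { apply Rmult_eq_reg_l with (A i / tau).
      - replace (A i / tau * (w' i - w i)) with (A i * ((w' i - w i) / tau))
          by (field; lra).
        rewrite Hs. field. lra.
      - apply Rgt_not_eq, Rdiv_lt_0_compat; lra. }
    assert (Hc : 0 < tau / (h * A i)).
    { apply Rdiv_lt_0_compat; [lra|]. apply Rmult_lt_0_compat; lra. }
    split; intros Hle.
    - assert (Hf := flux_le c _ _ (Hy i ltac:(lia)) Hle). nra.
    - assert (Hf := flux_le c _ _ (Hy (i + 1)%nat ltac:(lia)) Hle). nra. }
  assert (Hcmp : forall j p q, (1 <= j <= M)%nat -> p <= q ->
     (w j - w (j - 1)%nat = q * h -> w' j - w' (j - 1)%nat = p * h ->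
      y j <= D_h h w j / phi j)).
  { intros j p q Hj Hpq E1 E2. unfold y, D_h. rewrite E1, E2.
    assert (Hp := Hphi j Hj). assert (0 < / phi j) by (apply Rinv_0_lt_compat; lra).
    replace (p * h / h / phi j) with (p * / phi j) by (field; lra).
    replace (q * h / h / phi j) with (q * / phi j) by (field; lra). nra. }
  assert (Hcmp' : forall j p q, (1 <= j <= M)%nat -> q <= p ->
     (w j - w (j - 1)%nat = q * h -> w' j - w' (j - 1)%nat = p * h ->
      D_h h w j / phi j <= y j)).
  { intros j p q Hj Hpq E1 E2. unfold y, D_h. rewrite E1, E2.
    assert (Hp := Hphi j Hj). assert (0 < / phi j) by (apply Rinv_0_lt_compat; lra).
    replace (p * h / h / phi j) with (p * / phi j) by (field; lra).
    replace (q * h / h / phi j) with (q * / phi j) by (field; lra). nra. }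
  intros k Hk. fold (y k). split.
  - destruct (nat_argmax (fun j => - y j) M HM) as [j [Hj Hmin]].
    apply Rle_trans with (y j); [|specialize (Hmin k Hk); simpl in Hmin; lra].
    apply Rle_trans with (D_h h w j / phi j); [apply Hold; auto|].
    assert (R1 : w j <= w' j).
    { destruct (Nat.eq_dec j M) as [->|Hne]; [lra|].
      apply Hsign; [lia|]. specialize (Hmin (j + 1)%nat ltac:(lia)). simpl in Hmin. lra. }
    assert (R2 : w' (j - 1)%nat <= w (j - 1)%nat).
    { destruct (Nat.eq_dec j 1) as [->|Hne]; [simpl; lra|].
      apply Hsign; [lia|]. replace (j - 1 + 1)%nat with j by lia.
      specialize (Hmin (j - 1)%nat ltac:(lia)). simpl in Hmin. lra. }
    apply (Hcmp' j ((w' j - w' (j - 1)%nat) / h) ((w j - w (j - 1)%nat) / h));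
      [exact Hj| |field; lra|field; lra].
    apply Rmult_le_compat_r; [apply Rlt_le, Rinv_0_lt_compat; lra|lra].
  - destruct (nat_argmax y M HM) as [j [Hj Hmax]].
    apply Rle_trans with (y j); [auto|].
    apply Rle_trans with (D_h h w j / phi j); [|apply Hold; auto].
    assert (R1 : w' j <= w j).
    { destruct (Nat.eq_dec j M) as [->|Hne]; [lra|].
      apply Hsign; [lia|]. apply Hmax; lia. }
    assert (R2 : w (j - 1)%nat <= w' (j - 1)%nat).
    { destruct (Nat.eq_dec j 1) as [->|Hne]; [simpl; lra|].
      apply Hsign; [lia|]. replace (j - 1 + 1)%nat with j by lia. apply Hmax; lia. }
    apply (Hcmp j ((w' j - w' (j - 1)%nat) / h) ((w j - w (j - 1)%nat) / h));
      [exact Hj| |field; lra|field; lra].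
    apply Rmult_le_compat_r; [apply Rlt_le, Rinv_0_lt_compat; lra|lra].
Qed.

(** * Relative energy *)

(** The Bregman divergence, in the variable [D_h x], of the convex energy whose
    derivative is [flux], between the exact gradient [p] and the numerical
    gradient [p - e]. *)
Definition relative_energy (c : traj_case) (f e p : R) : R :=
  match c with
  | Case1 => f * (- ln ((p - e) / p) - e / p)
  | Case2 => e ^ 2 / (2 * f)
  end.

Lemma relative_energy_0 c f p : 0 < p -> relative_energy c f 0 p = 0.
Proof.
  intros Hp. destruct c; simpl.
  - replace ((p - 0) / p) with 1 by (field; lra). rewrite ln_1. field. lra.
  - unfold Rdiv. ring.
Qed.

Lemma ln_le_minus_1 y : 0 < y -> ln y <= y - 1.
Proof.
  intros Hy. assert (H := exp_ineq1_le (ln y)). rewrite exp_ln in H by exact Hy. lra.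
Qed.

(** In Case 1, with [y] the ratio of the two gradients, the inequality
    [ln z <= z - 1] at [z = sqrt y] gives [y - 1 - ln y >= (sqrt y - 1) ^ 2]. *)
Lemma relative_energy_coercive c bf Bf lo hi : 0 < bf <= Bf -> 0 < lo <= hi ->
  exists k, 0 < k /\ forall f e p, bf <= f <= Bf -> lo <= p <= hi ->
    lo <= p - e <= hi -> k * e ^ 2 <= relative_energy c f e p.
Proof.
  intros Hbf Hlo.
  destruct c.
  - set (Y := hi / lo).
    assert (HY : 0 < Y) by (apply Rdiv_lt_0_compat; lra).
    set (Z := (sqrt Y + 1) ^ 2).
    assert (HsY := sqrt_pos Y).
    assert (HZ : 0 < Z) by (unfold Z; apply pow_lt; lra).
    exists (bf * / (Z * hi ^ 2)).
    assert (Hhi2 : 0 < hi ^ 2) by (apply pow_lt; lra).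
    split. { apply Rmult_lt_0_compat; [lra|]. apply Rinv_0_lt_compat. nra. }
    intros f e p Hf Hp Hpe. cbn [relative_energy].
    set (y := (p - e) / p).
    assert (Hy : 0 < y) by (apply Rdiv_lt_0_compat; lra).
    assert (HyY : y <= Y).
    { unfold y, Y, Rdiv. apply Rmult_le_compat; try lra.
      - apply Rlt_le, Rinv_0_lt_compat; lra.
      - apply Rinv_le_contravar; lra. }
    assert (Hs := sqrt_lt_R0 y Hy). assert (Hss := sqrt_sqrt y (Rlt_le _ _ Hy)).
    set (s := sqrt y) in *.
    assert (HsY' : s <= sqrt Y) by (apply sqrt_le_1; lra).
    assert (Hln : ln y <= 2 * (s - 1)).
    { rewrite <- Hss, ln_mult by lra. assert (H := ln_le_minus_1 s Hs). lra. }
    replace (e / p) with (1 - y) by (unfold y; field; lra).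
    assert (Ee : e = p * (1 - y)) by (unfold y; field; lra).
    apply Rle_trans with (f * (s - 1) ^ 2).
    2: { apply Rmult_le_compat_l; [lra|]. nra. }
    assert (He2 : e ^ 2 = p ^ 2 * (s + 1) ^ 2 * (s - 1) ^ 2).
    { rewrite Ee, <- Hss. ring. }
    rewrite He2.
    assert (H1 : p ^ 2 * (s + 1) ^ 2 <= Z * hi ^ 2).
    { rewrite (Rmult_comm Z). unfold Z. apply Rmult_le_compat; try apply pow2_ge_0;
      apply pow_incr; lra. }
    assert (H2 : / (Z * hi ^ 2) * (p ^ 2 * (s + 1) ^ 2) <= 1).
    { apply Rmult_le_reg_l with (Z * hi ^ 2); [nra|].
      rewrite <- Rmult_assoc, Rinv_r by nra. lra. }
    assert (H3 := pow2_ge_0 (s - 1)).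
    replace (bf * / (Z * hi ^ 2) * (p ^ 2 * (s + 1) ^ 2 * (s - 1) ^ 2))
      with (bf * (/ (Z * hi ^ 2) * (p ^ 2 * (s + 1) ^ 2)) * (s - 1) ^ 2) by ring.
    apply Rmult_le_compat_r; [lra|]. nra.
  - exists (/ (2 * Bf)). split; [apply Rinv_0_lt_compat; lra|].
    intros f e p Hf Hp Hpe. simpl. unfold Rdiv. rewrite Rmult_comm.
    apply Rmult_le_compat_l; [nra|]. apply Rinv_le_contravar; lra.
Qed.

(** Convexity in [e] at fixed [p'], plus the cost [O(|p' - p| e^2)] of moving [p]
    to [p'] at fixed [e]. It is [e], not the numerical gradient, that stays fixed
    in this second move: otherwise an error of order [|p' - p|^2] appears. *)
Lemma relative_energy_step c Bf lo hi : 0 < Bf -> 0 < lo ->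
  exists K, 0 <= K /\ forall f e p e' p', 0 < f <= Bf ->
    lo <= p <= hi -> lo <= p - e -> lo <= p' <= hi -> lo <= p' - e' ->
    Rabs (p' - p) <= lo / 2 ->
    relative_energy c f e' p' - relative_energy c f e p
      - K * Rabs (p' - p) * e ^ 2
    <= (flux c (p' / f) - flux c ((p' - e') / f)) * (e' - e).
Proof.
  intros HBf Hlo. exists (Bf * (2 / lo ^ 3)).
  assert (Hl3 : 0 < lo ^ 3) by (apply pow_lt; lra).
  assert (Hl : 0 < 2 / lo ^ 3) by (apply Rdiv_lt_0_compat; lra).
  split; [nra|].
  intros f e p e' p' Hf Hp Hpe Hp' Hpe' Hd.
  assert (Hd' := Hd). apply Rabs_le_between in Hd'.
  assert (Hq : lo / 2 <= p' - e) by lra.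
  assert (He2 := pow2_ge_0 e). assert (Hpp := Rabs_pos (p' - p)).
  destruct c; cbn [relative_energy]; cbn [flux].
  - replace (- / (p' / f) - - / ((p' - e') / f)) with (f * (/ (p' - e') - / p'))
      by (field; lra).
    (* Convexity: the tangent inequality between the numerical gradients [p' - e'] and
       [p' - e]. *)
    assert (L1 : - ln ((p' - e') / p') - e' / p' - (- ln ((p' - e) / p') - e / p')
                 <= (/ (p' - e') - / p') * (e' - e)).
    { assert (H := ln_le_minus_1 ((p' - e) / (p' - e'))
                     ltac:(apply Rdiv_lt_0_compat; lra)).
      rewrite ln_div in H by lra. rewrite !ln_div by lra.
      replace ((/ (p' - e') - / p') * (e' - e)) with
        ((p' - e) / (p' - e') - 1 - e' / p' + e / p') by (field; lra).
      lra. }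
    (* Motion of [p] at fixed [e]: the first-order terms in [e] cancel exactly. *)
    assert (L2 : (- ln ((p' - e) / p') - e / p') - (- ln ((p - e) / p) - e / p)
                 <= 2 / lo ^ 3 * Rabs (p' - p) * e ^ 2).
    { assert (Hy : 0 < (p - e) / p) by (apply Rdiv_lt_0_compat; lra).
      assert (Hy' : 0 < (p' - e) / p') by (apply Rdiv_lt_0_compat; lra).
      assert (H := ln_le_minus_1 ((p - e) / p / ((p' - e) / p'))
                     ltac:(apply Rdiv_lt_0_compat; lra)).
      rewrite ln_div in H by assumption.
      apply Rle_trans with ((p - p') * (/ (p * p' * (p' - e))) * e ^ 2).
      { replace ((p - p') * / (p * p' * (p' - e)) * e ^ 2) with
          ((p - e) / p / ((p' - e) / p') - 1 - e / p' + e / p) by (field; lra).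
        lra. }
      apply Rmult_le_compat_r; [lra|]. rewrite (Rmult_comm (2 / lo ^ 3)).
      assert (Hden : lo ^ 3 / 2 <= p * p' * (p' - e)).
      { replace (lo ^ 3 / 2) with (lo * lo * (lo / 2)) by field.
        apply Rmult_le_compat; try nra. }
      assert (Hi : / (p * p' * (p' - e)) <= 2 / lo ^ 3).
      { replace (2 / lo ^ 3) with (/ (lo ^ 3 / 2)) by (field; lra).
        apply Rinv_le_contravar; lra. }
      assert (Hi0 : 0 < / (p * p' * (p' - e))) by (apply Rinv_0_lt_compat; lra).
      apply Rle_trans with (Rabs (p' - p) * / (p * p' * (p' - e))).
      - apply Rmult_le_compat_r; [lra|]. rewrite Rabs_minus_sym. apply Rle_abs.
      - apply Rmult_le_compat_l; lra. }
    assert (HX : 0 <= 2 / lo ^ 3 * Rabs (p' - p) * e ^ 2).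
    { apply Rmult_le_pos; [|lra]. apply Rmult_le_pos; lra. }
    set (E := 2 / lo ^ 3 * Rabs (p' - p) * e ^ 2) in *.
    replace (Bf * (2 / lo ^ 3) * Rabs (p' - p) * e ^ 2) with (Bf * E)
      by (unfold E; ring).
    apply Rle_trans with
      (f * (- ln ((p' - e') / p') - e' / p' - (- ln ((p - e) / p) - e / p) - E)).
    + assert (f * E <= Bf * E) by (apply Rmult_le_compat_r; lra). lra.
    + rewrite Rmult_assoc. apply Rmult_le_compat_l; lra.
  - assert (HX : 0 <= Bf * (2 / lo ^ 3) * Rabs (p' - p) * e ^ 2).
    { apply Rmult_le_pos; [|lra]. apply Rmult_le_pos; nra. }
    replace (p' / f - (p' - e') / f) with (e' / f) by (field; lra).
    assert (Hfi : 0 < / f) by (apply Rinv_0_lt_compat; lra).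
    replace (e' ^ 2 / (2 * f) - e ^ 2 / (2 * f)) with ((e' ^ 2 - e ^ 2) / 2 * / f)
      by (field; lra).
    replace (e' / f * (e' - e)) with ((e' * (e' - e)) * / f) by (field; lra).
    assert ((e' ^ 2 - e ^ 2) / 2 * / f <= (e' * (e' - e)) * / f).
    { apply Rmult_le_compat_r; [lra|]. assert (H := pow2_ge_0 (e' - e)). nra. }
    lra.
Qed.

(** * The energy inequality for one time step *)

Lemma mobility_bounds c m bf Bf lo hi : 0 < m -> 0 < bf <= Bf -> 0 < lo <= hi ->
  exists al A L, 0 < al /\ 0 <= L /\ forall f p q, bf <= f <= Bf ->
    lo <= p <= hi -> lo <= q <= hi ->
    al <= mobility c m f p <= A /\
    Rabs (mobility c m f p - mobility c m f q) <= L * Rabs (p - q).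
Proof.
  intros Hm Hbf Hlo. unfold mobility.
  set (e := match c with Case1 => m - 1 | Case2 => m + 1 end).
  assert (H0 : 0 < lo / Bf) by (apply Rdiv_lt_0_compat; lra).
  destruct (Rpower_bounds (lo / Bf) (hi / bf) e H0) as [K [k [Hk HK]]].
  destruct (Rpower_lipschitz (lo / Bf) (hi / bf) e H0) as [L [HL0 HL]].
  exists (bf / m * k), (Bf / m * K), (L / m).
  assert (Hmi : 0 < / m) by (apply Rinv_0_lt_compat; lra).
  split. { unfold Rdiv. repeat apply Rmult_lt_0_compat; lra. }
  split. { unfold Rdiv. apply Rmult_le_pos; lra. }
  intros f p q Hf Hp Hq.
  assert (Hfi : / Bf <= / f <= / bf) by (split; apply Rinv_le_contravar; lra).
  assert (HBi : 0 < / Bf) by (apply Rinv_0_lt_compat; lra).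
  assert (Hr : forall z, lo <= z <= hi -> lo / Bf <= z / f <= hi / bf).
  { intros z Hz. unfold Rdiv. split; apply Rmult_le_compat; lra. }
  split.
  - destruct (HK (p / f) (Hr p Hp)) as [E1 E2].
    assert (E3 := Rle_abs (Rpower (p / f) e)). unfold Rdiv at 1 2 4 5.
    assert (bf * / m <= f * / m <= Bf * / m) by (split; apply Rmult_le_compat_r; lra).
    assert (0 < bf * / m) by (apply Rmult_lt_0_compat; lra).
    split; apply Rmult_le_compat; lra.
  - assert (E := HL _ _ (Hr p Hp) (Hr q Hq)).
    rewrite <- Rmult_minus_distr_l, Rabs_mult, Rabs_pos_eq
      by (apply Rlt_le, Rdiv_lt_0_compat; lra).
    apply Rle_trans with (f / m * (L * Rabs (p / f - q / f))).
    + apply Rmult_le_compat_l; [apply Rlt_le, Rdiv_lt_0_compat; lra|exact E].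
    + replace (p / f - q / f) with ((p - q) * / f) by (field; lra).
      rewrite Rabs_mult, (Rabs_pos_eq (/ f)) by lra.
      apply Req_le. field. lra.
Qed.

Lemma Dt_h_interior h M l i : h <> 0 -> (1 <= i <= M - 1)%nat ->
  Dt_h h M l i = (D_h h l i + D_h h l (i + 1)) / 2.
Proof.
  intros Hh Hi. unfold Dt_h, D_h.
  rewrite (proj2 (Nat.eqb_neq i 0)), (proj2 (Nat.eqb_neq i M)) by lia.
  rewrite Nat.add_sub. field. exact Hh.
Qed.

Definition total_relative_energy (c : traj_case) (h : R) (M : nat)
    (phi u w : nat -> R) : R :=
  h * ssum (fun j => relative_energy c (phi j) (D_h h u j - D_h h w j) (D_h h u j)) M.

Definition gradient_in (h : R) (M : nat) (lo hi : R) (u : nat -> R) : Prop :=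
  forall j, (1 <= j <= M)%nat -> lo <= D_h h u j <= hi.

(** Test the difference of the two schemes against the time increment [delta] of the
    error.  Summation by parts turns the fluxes into increments of the relative energy.
    The mobility multiplies [delta ^ 2 / tau]; completing the square with it absorbs
    the remaining terms, namely the residual [r] and the difference of the two
    mobilities, which is bounded by the gradient error at the old time level. *)
Lemma energy_step c m bf Bf lo hi B V ell :
  0 < m -> 0 < bf <= Bf -> 0 < lo <= hi -> 0 <= B -> 0 <= V -> 0 <= ell ->
  exists K, 0 <= K /\
  forall M h tau f phi u u' w w' r,
    (2 <= M)%nat -> 0 < h -> h * INR M <= ell -> 0 < tau -> B * tau <= lo / 2 ->
    (forall i, (1 <= i <= M - 1)%nat -> bf <= f i <= Bf) ->
    (forall j, (1 <= j <= M)%nat -> bf <= phi j <= Bf) ->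
    gradient_in h M lo hi u -> gradient_in h M lo hi u' ->
    gradient_in h M lo hi w -> gradient_in h M lo hi w' ->
    (forall j, (1 <= j <= M)%nat -> Rabs (D_h h u' j - D_h h u j) <= B * tau) ->
    u 0%nat = w 0%nat -> u M = w M -> u' 0%nat = w' 0%nat -> u' M = w' M ->
    implicit_step c M h tau (fun i => mobility c m (f i) (Dt_h h M w i)) phi w w' ->
    (forall i, (1 <= i <= M - 1)%nat -> Rabs ((u' i - u i) / tau) <= V) ->
    (forall i, (1 <= i <= M - 1)%nat ->
       Rabs (mobility c m (f i) (Dt_h h M u i) * ((u' i - u i) / tau)
             - (flux c (D_h h u' (i + 1) / phi (i + 1)%nat)
                - flux c (D_h h u' i / phi i)) / h) <= r) ->
    total_relative_energy c h M phi u' w'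
      <= total_relative_energy c h M phi u w
         + K * tau * (total_relative_energy c h M phi u w + r ^ 2).
Proof.
  intros Hm Hbf Hlo HB HV Hell.
  destruct (relative_energy_coercive c bf Bf lo hi Hbf Hlo) as [k [Hk Hco]].
  destruct (relative_energy_step c Bf lo hi ltac:(lra) ltac:(lra)) as [K1 [HK1 Hst]].
  destruct (mobility_bounds c m bf Bf lo hi Hm Hbf Hlo) as [al [A [L [Hal [HL Hmob]]]]].
  set (LV := L * V). assert (HLV : 0 <= LV) by (apply Rmult_le_pos; lra).
  set (K2 := K1 * B + LV ^ 2 / (2 * al)).
  assert (Hali : 0 < / (2 * al)) by (apply Rinv_0_lt_compat; lra).
  assert (HLV2 : 0 <= LV ^ 2 / (2 * al)) by (apply Rmult_le_pos; [apply pow2_ge_0|lra]).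
  assert (HK2 : 0 <= K2) by (unfold K2; assert (0 <= K1 * B) by (apply Rmult_le_pos; lra); lra).
  assert (Hell2 : 0 <= ell / (2 * al)) by (apply Rmult_le_pos; lra).
  exists (K2 / k + ell / (2 * al)).
  assert (HK2k : 0 <= K2 / k).
  { apply Rmult_le_pos; [lra|]. apply Rlt_le, Rinv_0_lt_compat; lra. }
  split; [lra|].
  intros M h tau f phi u u' w w' r HM Hh HhM Ht HBt Hf Hphi Gu Gu' Gw Gw' HDt
    B0 BM B0' BM' [Hs _] HVu Hres.
  set (E := fun j => D_h h u j - D_h h w j).
  set (E' := fun j => D_h h u' j - D_h h w' j).
  set (Psi := fun j => flux c (D_h h u' j / phi j) - flux c (D_h h w' j / phi j)).
  set (delta := fun i => (u' i - w' i) - (u i - w i)).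
  set (S2 := ssum (fun j => E j ^ 2) M).
  assert (HS2 : 0 <= S2) by (apply ssum_nonneg; intros; apply pow2_ge_0).
  unfold total_relative_energy.
  set (G := ssum _ M). set (G' := ssum _ M).
  assert (HGS : k * S2 <= G').
  { unfold S2, G'. rewrite <- ssum_scal. apply ssum_le. intros j Hj.
    apply Hco; auto. replace (_ - _) with (D_h h w j) by ring. auto. }
  assert (HA : G - G' - K1 * B * tau * S2 <= ssum (fun j => Psi j * (E' j - E j)) M).
  { apply Rle_trans with (ssum (fun j =>
      (relative_energy c (phi j) (E' j) (D_h h u' j)
       + -1 * relative_energy c (phi j) (E j) (D_h h u j))
      + - (K1 * B * tau) * E j ^ 2) M).
    - apply Req_le. rewrite !ssum_plus, !ssum_scal. unfold G, G', S2, E, E'. ring.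
    - apply ssum_le. intros j Hj.
      assert (H := Hst (phi j) (E j) (D_h h u j) (E' j) (D_h h u' j)
        ltac:(specialize (Hphi j Hj); lra) (Gu j Hj)
        ltac:(unfold E; specialize (Gw j Hj); lra) (Gu' j Hj)
        ltac:(unfold E'; specialize (Gw' j Hj); lra)
        ltac:(specialize (HDt j Hj); lra)).
      replace (D_h h u' j - E' j) with (D_h h w' j) in H by (unfold E'; ring).
      fold (Psi j) in H.
      assert (H2 : K1 * Rabs (D_h h u' j - D_h h u j) * E j ^ 2
                   <= K1 * (B * tau) * E j ^ 2).
      { apply Rmult_le_compat_r; [apply pow2_ge_0|].
        apply Rmult_le_compat_l; [lra|auto]. }
      lra. }
  (* Completion of the square at one node. *)
  assert (Hterm : forall i, (1 <= i <= M - 1)%nat ->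
     - ((Psi (i + 1)%nat - Psi i) * delta i)
     <= h * tau / (4 * al) * (LV ^ 2 * (E i ^ 2 + E (i + 1)%nat ^ 2) + 2 * r ^ 2)).
  { intros i Hi.
    assert (Hwi : lo <= Dt_h h M w i <= hi).
    { rewrite Dt_h_interior by (auto; lra).
      assert (X1 := Gw i ltac:(lia)). assert (X2 := Gw (i + 1)%nat ltac:(lia)). lra. }
    assert (Hui : lo <= Dt_h h M u i <= hi).
    { rewrite Dt_h_interior by (auto; lra).
      assert (X1 := Gu i ltac:(lia)). assert (X2 := Gu (i + 1)%nat ltac:(lia)). lra. }
    destruct (Hmob (f i) _ _ (Hf i Hi) Hwi Hui) as [[Ha _] _].
    destruct (Hmob (f i) _ _ (Hf i Hi) Hui Hwi) as [_ Hl].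
    set (a := mobility c m (f i) (Dt_h h M w i)) in *.
    set (au := mobility c m (f i) (Dt_h h M u i)) in *.
    specialize (Hres i Hi). fold au in Hres.
    set (Rm := au * ((u' i - u i) / tau) - _) in Hres.
    set (b := (au - a) * ((u' i - u i) / tau) - Rm).
    assert (Hid : (Psi (i + 1)%nat - Psi i) = h * (a * (delta i / tau) + b)).
    { specialize (Hs i Hi). fold a in Hs.
      replace (a * (delta i / tau) + b) with
        (au * ((u' i - u i) / tau) - a * ((w' i - w i) / tau) - Rm)
        by (unfold b, delta; field; lra).
      rewrite Hs. unfold Rm, Psi. field. lra. }
    assert (Hb : Rabs b <= LV * Rabs ((E i + E (i + 1)%nat) / 2) + r).
    { unfold b. apply Rabs_plus_le; [|rewrite Rabs_Ropp; exact Hres].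
      unfold LV. replace (L * V * _) with
        (L * Rabs ((E i + E (i + 1)%nat) / 2) * V) by ring.
      apply Rabs_mult_le; [|auto].
      replace ((E i + E (i + 1)%nat) / 2) with (Dt_h h M u i - Dt_h h M w i); [exact Hl|].
      rewrite !Dt_h_interior by (auto; lra). unfold E. field. }
    assert (Hb2 : b ^ 2 <= LV ^ 2 * (E i ^ 2 + E (i + 1)%nat ^ 2) + 2 * r ^ 2).
    { rewrite <- (pow2_abs b). set (z := (E i + E (i + 1)%nat) / 2) in *.
      assert (Hz : z ^ 2 <= (E i ^ 2 + E (i + 1)%nat ^ 2) / 2).
      { unfold z. assert (H := pow2_ge_0 (E i - E (i + 1)%nat)). nra. }
      assert (Hz2 : (LV * Rabs z) ^ 2 <= LV ^ 2 * ((E i ^ 2 + E (i + 1)%nat ^ 2) / 2)).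
      { rewrite Rpow_mult_distr, pow2_abs.
        apply Rmult_le_compat_l; [apply pow2_ge_0|exact Hz]. }
      assert (H1 : Rabs b ^ 2 <= (LV * Rabs z + r) ^ 2).
      { apply pow_incr. split; [apply Rabs_pos|exact Hb]. }
      assert (H2 := pow2_ge_0 (LV * Rabs z - r)). nra. }
    rewrite Hid.
    assert (Hsq : 0 <= a * (delta i / tau + b / (2 * a)) ^ 2).
    { apply Rmult_le_pos; [lra|apply pow2_ge_0]. }
    replace (- (h * (a * (delta i / tau) + b) * delta i)) with
      (h * tau * (b ^ 2 * / (4 * a) - a * (delta i / tau + b / (2 * a)) ^ 2))
      by (field; lra).
    apply Rle_trans with (h * tau * (b ^ 2 * / (4 * a))).
    - apply Rmult_le_compat_l; [nra|lra].
    - set (Y := LV ^ 2 * (E i ^ 2 + E (i + 1)%nat ^ 2) + 2 * r ^ 2) in *.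
      replace (h * tau / (4 * al) * Y) with (h * tau * (Y * / (4 * al)))
        by (field; lra).
      apply Rmult_le_compat_l; [nra|]. apply Rmult_le_compat.
      + apply pow2_ge_0.
      + apply Rlt_le, Rinv_0_lt_compat; lra.
      + exact Hb2.
      + apply Rinv_le_contravar; lra. }
  assert (HBsum : h * ssum (fun j => Psi j * (E' j - E j)) M
     <= h * tau / (4 * al) * (LV ^ 2 * (2 * S2) + INR M * (2 * r ^ 2))).
  { rewrite <- ssum_scal.
    rewrite (ssum_ext _ (fun j => Psi j * (delta j - delta (j - 1)%nat)))
      by (intros j Hj; unfold E, E', delta, D_h; field; lra).
    rewrite summation_by_parts by lia.
    replace (delta M) with 0 by (unfold delta; lra).
    replace (delta 0%nat) with 0 by (unfold delta; lra).
    apply Rle_trans with (ssum (fun i => h * tau / (4 * al)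
        * (LV ^ 2 * (E i ^ 2 + E (i + 1)%nat ^ 2) + 2 * r ^ 2)) (M - 1)).
    { replace (_ - _ - _) with
        (-1 * ssum (fun i => (Psi (i + 1)%nat - Psi i) * delta i) (M - 1)) by ring.
      rewrite <- ssum_scal. apply ssum_le. intros i Hi.
      specialize (Hterm i Hi). lra. }
    rewrite ssum_scal. apply Rmult_le_compat_l.
    { apply Rlt_le, Rdiv_lt_0_compat; [|lra]. apply Rmult_lt_0_compat; lra. }
    rewrite ssum_plus, ssum_scal, ssum_plus, ssum_const.
    apply Rplus_le_compat.
    - apply Rmult_le_compat_l; [apply pow2_ge_0|].
      assert (X1 := ssum_pred_le (fun j => E j ^ 2) M ltac:(intros; apply pow2_ge_0)).
      assert (X2 := ssum_shift_le (fun j => E j ^ 2) M ltac:(intros; apply pow2_ge_0)).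
      cbv beta in X1, X2. fold S2 in X1, X2. lra.
    - apply Rmult_le_compat_r; [|apply le_INR; lia].
      assert (H := pow2_ge_0 r). lra. }
  assert (HA' : h * G - h * G' - K1 * B * tau * (h * S2)
                <= h * ssum (fun j => Psi j * (E' j - E j)) M).
  { replace (_ - _ - _) with (h * (G - G' - K1 * B * tau * S2)) by ring.
    apply Rmult_le_compat_l; lra. }
  assert (Hfin : h * tau / (4 * al) * (LV ^ 2 * (2 * S2) + INR M * (2 * r ^ 2))
     <= tau * (LV ^ 2 / (2 * al) * (h * S2)) + tau * (ell / (2 * al) * r ^ 2)).
  { replace (h * tau / (4 * al) * _) with
      (tau * (LV ^ 2 / (2 * al) * (h * S2)) + tau * ((h * INR M) / (2 * al) * r ^ 2))
      by (field; lra).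
    apply Rplus_le_compat_l, Rmult_le_compat_l; [lra|].
    apply Rmult_le_compat_r; [apply pow2_ge_0|].
    apply Rmult_le_compat_r; lra. }
  assert (HhS : K2 * (h * S2) <= K2 / k * (h * G')).
  { unfold Rdiv. rewrite Rmult_assoc. apply Rmult_le_compat_l; [lra|].
    apply Rmult_le_reg_l with k; [lra|].
    rewrite <- (Rmult_assoc k (/ k)), Rinv_r by lra. nra. }
  assert (HG0 : 0 <= h * G').
  { assert (0 <= k * S2) by (apply Rmult_le_pos; lra).
    apply Rmult_le_pos; lra. }
  assert (Hr2 := pow2_ge_0 r).
  apply Rle_trans with (h * G' + tau * (K2 * (h * S2)) + tau * (ell / (2 * al) * r ^ 2)).
  { unfold K2. lra. }
  assert (X1 : tau * (K2 * (h * S2)) <= tau * (K2 / k * (h * G'))).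
  { apply Rmult_le_compat_l; lra. }
  assert (X2 : 0 <= tau * (K2 / k * r ^ 2)).
  { apply Rmult_le_pos; [lra|]. apply Rmult_le_pos; lra. }
  assert (X3 : 0 <= tau * (ell / (2 * al) * (h * G'))).
  { apply Rmult_le_pos; [lra|]. apply Rmult_le_pos; lra. }
  lra.
Qed.

Lemma discrete_gronwall (G : nat -> R) (K tau r2 : R) N :
  0 <= K -> 0 < tau -> 0 <= r2 -> G 0%nat = 0 ->
  (forall n, (n < N)%nat -> G (S n) <= G n + K * tau * (G n + r2)) ->
  forall n, (n <= N)%nat -> G n <= exp (K * (INR n * tau)) * r2.
Proof.
  intros HK Ht Hr H0 Hs n Hn.
  assert (H : G n + r2 <= exp (K * (INR n * tau)) * r2).
  { induction n as [|n IH].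
    - rewrite H0. simpl INR. rewrite Rmult_0_l, Rmult_0_r, exp_0. lra.
    - specialize (IH ltac:(lia)). specialize (Hs n ltac:(lia)).
      rewrite S_INR.
      replace (K * ((INR n + 1) * tau)) with (K * tau + K * (INR n * tau)) by ring.
      rewrite exp_plus, Rmult_assoc.
      assert (H1 := exp_ineq1_le (K * tau)).
      assert (HKt : 0 <= K * tau) by (apply Rmult_le_pos; lra).
      apply Rle_trans with ((1 + K * tau) * (exp (K * (INR n * tau)) * r2)).
      + apply Rle_trans with ((1 + K * tau) * (G n + r2)); [lra|].
        apply Rmult_le_compat_l; lra.
      + apply Rmult_le_compat_r; [|lra].
        apply Rmult_le_pos; [apply Rlt_le, exp_pos|lra]. }
  lra.
Qed.

(** * Discrete inner products *)

Lemma inner_ssum h M l g : inner h M l g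
  = h * (/ 2 * l 0%nat * g 0%nat + ssum (fun i => l i * g i) (M - 1) + / 2 * l M * g M).
Proof. reflexivity. Qed.

Lemma norm2_le h M l C eps :
  0 <= eps -> inner h M l l <= C * eps ^ 2 -> norm2 h M l <= sqrt C * eps.
Proof.
  intros He HC. unfold norm2. rewrite <- (sqrt_pow2 eps) at 1 by exact He.
  destruct (Rle_dec 0 C) as [H0|H0].
  - rewrite <- sqrt_mult by (try apply pow2_ge_0; exact H0).
    apply sqrt_le_1_alt. exact HC.
  - assert (H2 := pow2_ge_0 eps).
    rewrite sqrt_neg_0 by nra. apply Rmult_le_pos; apply sqrt_pos.
Qed.

(** [l i] is [h] times the sum of the first [i] gradients, to which the
    Cauchy-Schwarz inequality applies. *)
Lemma discrete_poincare h M l : (1 <= M)%nat -> 0 < h -> l 0%nat = 0 -> l M = 0 ->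
  inner h M l l <= (h * INR M) ^ 2 * (h * ssum (fun j => D_h h l j ^ 2) M).
Proof.
  intros HM Hh H0 HlM. set (S2 := ssum _ M).
  assert (HS2 : 0 <= S2) by (apply ssum_nonneg; intros; apply pow2_ge_0).
  assert (Hl : forall i, l i = h * ssum (D_h h l) i).
  { induction i as [|i IH]; [rewrite ssum_0; lra|].
    rewrite ssum_S, Rmult_plus_distr_l, <- IH. unfold D_h.
    replace (S i - 1)%nat with i by lia. field. lra. }
  rewrite inner_ssum, H0, HlM.
  assert (HMp := pos_INR M).
  assert (Hsum : ssum (fun i => l i * l i) (M - 1) <= INR M * (h ^ 2 * (INR M * S2))).
  { apply Rle_trans with (ssum (fun _ => h ^ 2 * (INR M * S2)) (M - 1)).
    - apply ssum_le. intros i Hi. rewrite (Hl i).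
      replace (h * _ * (h * _)) with (h ^ 2 * (ssum (D_h h l) i) ^ 2) by ring.
      apply Rmult_le_compat_l; [apply pow2_ge_0|].
      eapply Rle_trans; [apply ssum_cauchy_one|].
      apply Rmult_le_compat; [apply pos_INR| |apply le_INR; lia|].
      + apply ssum_nonneg; intros; apply pow2_ge_0.
      + apply ssum_le_ssum; [lia|]. intros; apply pow2_ge_0.
    - rewrite ssum_const. apply Rmult_le_compat_r; [|apply le_INR; lia].
      apply Rmult_le_pos; [apply pow2_ge_0|]. apply Rmult_le_pos; lra. }
  apply Rle_trans with (h * (INR M * (h ^ 2 * (INR M * S2)))).
  - apply Rmult_le_compat_l; lra.
  - apply Req_le. ring.
Qed.

(** At the ends, [Dt_h] extrapolates linearly from the two nearest cells. *)
Lemma Dt_h_left h M l : h <> 0 ->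
  Dt_h h M l 0 = D_h h l 1 + (D_h h l 1 - D_h h l 2) / 2.
Proof. intros Hh. unfold Dt_h, D_h. simpl. field. exact Hh. Qed.

Lemma Dt_h_right h M l : h <> 0 -> (2 <= M)%nat ->
  Dt_h h M l M = D_h h l M + (D_h h l M - D_h h l (M - 1)) / 2.
Proof.
  intros Hh HM. unfold Dt_h, D_h.
  rewrite (proj2 (Nat.eqb_neq M 0)), Nat.eqb_refl by lia.
  replace (M - 1 - 1)%nat with (M - 2)%nat by lia. field. exact Hh.
Qed.

Lemma Dt_h_minus h M u w i : h <> 0 ->
  Dt_h h M (fun i => u i - w i) i = Dt_h h M u i - Dt_h h M w i.
Proof.
  intros Hh. unfold Dt_h. destruct (Nat.eqb i 0); [field; exact Hh|].
  destruct (Nat.eqb i M); field; exact Hh.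
Qed.

Lemma inner_Dt_h_le h M l : (2 <= M)%nat -> 0 < h ->
  inner h M (Dt_h h M l) (Dt_h h M l) <= 6 * (h * ssum (fun j => D_h h l j ^ 2) M).
Proof.
  intros HM Hh. set (S2 := ssum _ M). rewrite inner_ssum.
  assert (Hnn : forall j, 0 <= D_h h l j ^ 2) by (intros; apply pow2_ge_0).
  assert (Hterm : forall j, (1 <= j <= M)%nat -> D_h h l j ^ 2 <= S2).
  { intros j Hj. apply (ssum_term_le (fun j => D_h h l j ^ 2)); auto. }
  assert (Hend : forall j k, (1 <= j <= M)%nat -> (1 <= k <= M)%nat ->
    forall z, z = D_h h l j + (D_h h l j - D_h h l k) / 2 ->
      / 2 * z * z <= 5 / 2 * S2).
  { intros j k Hj Hk z ->. assert (X1 := Hterm j Hj). assert (X2 := Hterm k Hk).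
    assert (X3 := pow2_ge_0 (D_h h l j + 3 * D_h h l k)). nra. }
  assert (E0 := Hend 1%nat 2%nat ltac:(lia) ltac:(lia) _ (Dt_h_left h M l ltac:(lra))).
  assert (EM := Hend M (M - 1)%nat ltac:(lia) ltac:(lia) _
                  (Dt_h_right h M l ltac:(lra) HM)).
  assert (ES : ssum (fun i => Dt_h h M l i * Dt_h h M l i) (M - 1) <= S2).
  { apply Rle_trans with
      (ssum (fun i => / 2 * (D_h h l i ^ 2 + D_h h l (i + 1) ^ 2)) (M - 1)).
    - apply ssum_le. intros i Hi. rewrite Dt_h_interior by (auto; lra).
      assert (X := pow2_ge_0 (D_h h l i - D_h h l (i + 1))). nra.
    - rewrite ssum_scal, ssum_plus.
      assert (X1 := ssum_pred_le (fun j => D_h h l j ^ 2) M ltac:(intros; apply pow2_ge_0)).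
      assert (X2 := ssum_shift_le (fun j => D_h h l j ^ 2) M ltac:(intros; apply pow2_ge_0)).
      cbv beta in X1, X2. fold S2 in X1, X2. lra. }
  replace (6 * (h * S2)) with (h * (6 * S2)) by ring.
  apply Rmult_le_compat_l; lra.
Qed.

Lemma inner_le h M d g k r : (1 <= M)%nat -> 0 <= h ->
  (forall i, (i <= M)%nat -> d i ^ 2 <= k * g i ^ 2 + r) ->
  inner h M d d <= k * inner h M g g + r * (h * INR M).
Proof.
  intros HM Hh Hd. rewrite !inner_ssum.
  assert (HS : ssum (fun i => d i * d i) (M - 1)
               <= k * ssum (fun i => g i * g i) (M - 1) + INR (M - 1) * r).
  { rewrite <- ssum_const, <- ssum_scal, <- ssum_plus. apply ssum_le.
    intros i Hi. specialize (Hd i ltac:(lia)). lra. }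
  assert (H0 := Hd 0%nat ltac:(lia)). assert (H1 := Hd M ltac:(lia)).
  rewrite minus_INR in HS by lia. simpl (INR 1) in HS.
  replace (k * (h * _) + _) with (h * (k * (/ 2 * g 0%nat * g 0%nat
    + ssum (fun i => g i * g i) (M - 1) + / 2 * g M * g M) + INR M * r)) by ring.
  apply Rmult_le_compat_l; [exact Hh|]. lra.
Qed.

Lemma inner_ends h M l i : 0 <= h -> i = 0%nat \/ i = M ->
  h / 2 * l i ^ 2 <= inner h M l l.
Proof.
  intros Hh Hi. rewrite inner_ssum.
  assert (HS : 0 <= ssum (fun i => l i * l i) (M - 1)).
  { apply ssum_nonneg. intros j _. assert (X := pow2_ge_0 (l j)). lra. }
  assert (X0 := pow2_ge_0 (l 0%nat)). assert (XM := pow2_ge_0 (l M)).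
  replace (h / 2 * l i ^ 2) with (h * (/ 2 * l i ^ 2)) by field.
  apply Rmult_le_compat_l; [exact Hh|]. destruct Hi as [-> | ->]; lra.
Qed.

(** * Consistency *)

Section ExactSolution.

Variables (c : traj_case) (a b T m bf Bf B beta : R) (f0 : R -> R).
Variable x : nat -> nat -> R -> R -> R.

Hypothesis Hab : a < b.
Hypothesis HT : 0 < T.
Hypothesis Hm : 1 < m.
Hypothesis Hbf : 0 < bf.
Hypothesis Hf0 : forall X, a <= X <= b -> bf <= f0 X <= Bf.
Hypothesis Hx_X : forall j k, (j + k < 4)%nat ->
  forall X t, a <= X <= b -> 0 <= t <= T ->
  D_in (fun Y => x j k Y t) (fun Y => x (S j) k Y t) (fun Y => a <= Y <= b) X.
Hypothesis Hx_t : forall j k, (j + k < 4)%nat ->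
  forall X t, a <= X <= b -> 0 <= t <= T ->
  D_in (fun s => x j k X s) (fun s => x j (S k) X s) (fun s => 0 <= s <= T) t.
Hypothesis HB : forall j k, (j + k <= 4)%nat ->
  forall X t, a <= X <= b -> 0 <= t <= T -> Rabs (x j k X t) <= B.
Hypothesis HabB : b - a <= B.
Hypothesis Hbeta : 0 < beta.
Hypothesis Hx10 : forall X t, a <= X <= b -> 0 <= t <= T -> beta <= x 1%nat 0%nat X t.
Hypothesis Heq : forall X t, a < X < b -> 0 < t <= T ->
  trajectory_equation c m f0 x X t.

Hypothesis Hends : forall t, 0 <= t <= T ->
  x 0%nat 0%nat a t = a /\ x 0%nat 0%nat b t = b.
Hypothesis Hinit : forall X, a <= X <= b -> x 0%nat 0%nat X 0 = X.

Let B_pos : 0 < B.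
Proof. lra. Qed.

Lemma x10_range X t : a <= X <= b -> 0 <= t <= T -> beta <= x 1%nat 0%nat X t <= B.
Proof.
  intros HX Ht. split; [auto|]. eapply Rle_trans; [apply Rle_abs|].
  apply HB; auto.
Qed.

Lemma density_range X t : a <= X <= b -> 0 <= t <= T ->
  bf / B <= f0 X / x 1%nat 0%nat X t <= Bf / beta.
Proof.
  intros HX Ht. assert (H1 := x10_range X t HX Ht). assert (H2 := Hf0 X HX).
  assert (H3 : / B <= / x 1%nat 0%nat X t) by (apply Rinv_le_contravar; lra).
  assert (H4 : / x 1%nat 0%nat X t <= / beta) by (apply Rinv_le_contravar; lra).
  assert (H5 : 0 < / B) by (apply Rinv_0_lt_compat; lra).
  unfold Rdiv. split; apply Rmult_le_compat; lra.
Qed.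

Lemma difference_quotient_range Y Z t : a <= Y -> Y < Z -> Z <= b -> 0 <= t <= T ->
  beta <= (x 0%nat 0%nat Z t - x 0%nat 0%nat Y t) / (Z - Y) <= B.
Proof.
  intros HY HYZ HZ Ht.
  destruct (mean_value_D_in (fun Y => x 0%nat 0%nat Y t) (fun Y => x 1%nat 0%nat Y t)
     a b Y Z) as [w [Hw [_ ->]]]; try lra.
  { intros w Hw. apply Hx_X; auto; lia. }
  replace (_ / _) with (x 1%nat 0%nat w t) by (field; lra).
  apply x10_range; auto.
Qed.

Lemma jet_x j n t : (j + n <= 4)%nat -> 0 <= t <= T ->
  jet n a b B (fun k X => x (j + k) 0%nat X t).
Proof.
  intros Hjn Ht. split; [|split; [|lra]].
  - intros k Hk y Hy. replace (j + S k)%nat with (S (j + k)) by lia.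
    apply Hx_X; auto; lia.
  - intros k Hk y Hy. apply HB; auto; lia.
Qed.

Let p0 X t := x 1%nat 0%nat X t * x 0%nat 1%nat X t * / m.
Let p1 X t := (x 2%nat 0%nat X t * x 0%nat 1%nat X t
               + x 1%nat 0%nat X t * x 1%nat 1%nat X t) * / m.
Let p2 X t := ((x 3%nat 0%nat X t * x 0%nat 1%nat X t
                + x 2%nat 0%nat X t * x 1%nat 1%nat X t)
               + (x 2%nat 0%nat X t * x 1%nat 1%nat X t
                  + x 1%nat 0%nat X t * x 2%nat 1%nat X t)) * / m.

(** The derivatives of the density [q], computed from
    [d_X q = - p0 * q ^ (2 - m)].  The right-hand side contains derivatives of [x] but
    none of [f0], so that [q] inherits its regularity from [x] alone. *)
Definition density_jet (t : R) (k : nat) (X : R) : R :=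
  let q := f0 X / x 1%nat 0%nat X t in
  match k with
  | 0%nat => q
  | 1%nat => - p0 X t * Rpower q (2 - m)
  | 2%nat => - p1 X t * Rpower q (2 - m)
             + (2 - m) * (p0 X t * p0 X t) * Rpower q (3 - 2 * m)
  | _ => - p2 X t * Rpower q (2 - m)
         + (2 - m) * (p0 X t * p1 X t) * Rpower q (3 - 2 * m)
         + ((2 - m) * (2 * (p0 X t * p1 X t)) * Rpower q (3 - 2 * m)
            + - ((2 - m) * (3 - 2 * m) * (p0 X t * (p0 X t * p0 X t)))
              * Rpower q (4 - 3 * m))
  end.

Lemma density_jet_derive t X k : (k < 3)%nat -> a < X < b -> 0 < t <= T ->
  is_derive (density_jet t k) X (density_jet t (S k) X).
Proof.
  intros Hk HX Ht.
  assert (Hq : is_derive (density_jet t 0) X (density_jet t 1 X)).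
  { assert (H1 := Hf0 X ltac:(lra)).
    assert (H2 := x10_range X t ltac:(lra) ltac:(lra)).
    evar_last.
    - apply (trajectory_equation_density c m f0 x X t); auto; lra.
    - unfold density_jet, p0, Rdiv. ring. }
  assert (Hq0 : 0 < density_jet t 0 X).
  { assert (H1 := Hf0 X ltac:(lra)).
    assert (H2 := x10_range X t ltac:(lra) ltac:(lra)).
    apply Rdiv_lt_0_compat; lra. }
  assert (Hxd : forall i j, (i + j < 4)%nat ->
     is_derive (fun Y => x i j Y t) X (x (S i) j X t)).
  { intros i j Hij. apply (D_in_is_derive _ (fun Y => x (S i) j Y t) a b); [lra|].
    apply Hx_X; auto; lra. }
  assert (Hp0 : is_derive (fun Y => p0 Y t) X (p1 X t)).
  { unfold p0, p1. evar_last.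
    - apply is_derive_Rmult; [|apply @is_derive_const].
      apply is_derive_Rmult; apply Hxd; lia.
    - unfold zero; simpl. ring. }
  assert (Hp1 : is_derive (fun Y => p1 Y t) X (p2 X t)).
  { unfold p1, p2. evar_last.
    - apply is_derive_Rmult; [|apply @is_derive_const].
      apply (is_derive_plus (fun Y => x 2%nat 0%nat Y t * x 0%nat 1%nat Y t)
               (fun Y => x 1%nat 0%nat Y t * x 1%nat 1%nat Y t));
      apply is_derive_Rmult; apply Hxd; lia.
    - unfold zero, plus; simpl. ring. }
  assert (HR : forall e, is_derive (fun Y => Rpower (density_jet t 0 Y) e) X
     (- e * p0 X t * Rpower (density_jet t 0 X) (e + 1 - m))).
  { intros e. evar_last.
    - apply is_derive_Rpower; [exact Hq0|exact Hq].
    - unfold density_jet at 2. fold (density_jet t 0 X).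
      replace (e + 1 - m) with ((e - 1) + (2 - m)) by ring.
      rewrite Rpower_plus. change (f0 X / x 1%nat 0%nat X t) with (density_jet t 0 X).
      ring. }
  destruct k as [|[|[|k]]]; [exact Hq| | |lia].
  - evar_last.
    + apply is_derive_Rmult; [|apply (HR (2 - m))].
      apply @is_derive_opp. exact Hp0.
    + unfold opp; simpl.
      replace (2 - m + 1 - m) with (3 - 2 * m) by ring.
      change (f0 X / x 1%nat 0%nat X t) with (density_jet t 0 X).
      cbv beta. ring.
  - evar_last.
    + apply (is_derive_plus
        (fun Y => - p1 Y t * Rpower (density_jet t 0 Y) (2 - m))
        (fun Y => (2 - m) * (p0 Y t * p0 Y t) * Rpower (density_jet t 0 Y) (3 - 2 * m))).
      * apply is_derive_Rmult; [|apply (HR (2 - m))].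
        apply @is_derive_opp. exact Hp1.
      * apply is_derive_Rmult; [|apply (HR (3 - 2 * m))].
        apply is_derive_scal. apply is_derive_Rmult; exact Hp0.
    + unfold opp, plus; simpl.
      replace (2 - m + 1 - m) with (3 - 2 * m) by ring.
      replace (3 - 2 * m + 1 - m) with (4 - 3 * m) by ring.
      change (f0 X / x 1%nat 0%nat X t) with (density_jet t 0 X).
      ring.
Qed.

Lemma density_jet_bounded : exists Bq, 0 <= Bq /\ forall k, (k <= 3)%nat ->
  forall X t, a <= X <= b -> 0 <= t <= T -> Rabs (density_jet t k X) <= Bq.
Proof.
  assert (Hpos : 0 < bf / B) by (apply Rdiv_lt_0_compat; lra).
  destruct (Rpower_bounds (bf / B) (Bf / beta) (2 - m) Hpos) as [K2 [k2 [_ HK2]]].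
  destruct (Rpower_bounds (bf / B) (Bf / beta) (3 - 2 * m) Hpos) as [K3 [k3 [_ HK3]]].
  destruct (Rpower_bounds (bf / B) (Bf / beta) (4 - 3 * m) Hpos) as [K4 [k4 [_ HK4]]].
  assert (HR2 : forall X t, a <= X <= b -> 0 <= t <= T ->
    Rabs (Rpower (f0 X / x 1%nat 0%nat X t) (2 - m)) <= K2)
    by (intros; apply HK2, density_range; auto).
  assert (HR3 : forall X t, a <= X <= b -> 0 <= t <= T ->
    Rabs (Rpower (f0 X / x 1%nat 0%nat X t) (3 - 2 * m)) <= K3)
    by (intros; apply HK3, density_range; auto).
  assert (HR4 : forall X t, a <= X <= b -> 0 <= t <= T ->
    Rabs (Rpower (f0 X / x 1%nat 0%nat X t) (4 - 3 * m)) <= K4)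
    by (intros; apply HK4, density_range; auto).
  assert (Hp0 : exists P, forall X t, a <= X <= b -> 0 <= t <= T -> Rabs (p0 X t) <= P).
  { eexists. intros X t HX Ht. unfold p0.
    apply Rabs_mult_le; [apply Rabs_mult_le|apply Rle_refl]; apply HB; auto; lia. }
  assert (Hp1 : exists P, forall X t, a <= X <= b -> 0 <= t <= T -> Rabs (p1 X t) <= P).
  { eexists. intros X t HX Ht. unfold p1.
    apply Rabs_mult_le; [apply Rabs_plus_le; apply Rabs_mult_le|apply Rle_refl];
      apply HB; auto; lia. }
  assert (Hp2 : exists P, forall X t, a <= X <= b -> 0 <= t <= T -> Rabs (p2 X t) <= P).
  { eexists. intros X t HX Ht. unfold p2.
    apply Rabs_mult_le;
      [apply Rabs_plus_le; apply Rabs_plus_le; apply Rabs_mult_le|apply Rle_refl];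
      apply HB; auto; lia. }
  destruct Hp0 as [P0 HP0], Hp1 as [P1 HP1], Hp2 as [P2 HP2].
  assert (Hk : forall k, exists C, forall X t, a <= X <= b -> 0 <= t <= T ->
     Rabs (density_jet t k X) <= C).
  { intros [|[|[|k]]]; eexists; intros X t HX Ht; unfold density_jet.
    - rewrite Rabs_pos_eq; [apply density_range; auto|].
      assert (H := density_range X t HX Ht). lra.
    - apply Rabs_mult_le; [apply Rabs_opp_le; apply HP0|apply HR2]; auto.
    - apply Rabs_plus_le.
      + apply Rabs_mult_le; [apply Rabs_opp_le; apply HP1|apply HR2]; auto.
      + apply Rabs_mult_le; [|apply HR3; auto].
        apply Rabs_mult_le; [apply Rle_refl|]. apply Rabs_mult_le; apply HP0; auto.
    - apply Rabs_plus_le; [apply Rabs_plus_le|apply Rabs_plus_le].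
      + apply Rabs_mult_le; [apply Rabs_opp_le; apply HP2|apply HR2]; auto.
      + apply Rabs_mult_le; [|apply HR3; auto].
        apply Rabs_mult_le; [apply Rle_refl|].
        apply Rabs_mult_le; [apply HP0|apply HP1]; auto.
      + apply Rabs_mult_le; [|apply HR3; auto].
        apply Rabs_mult_le; [apply Rle_refl|]. apply Rabs_mult_le; [apply Rle_refl|].
        apply Rabs_mult_le; [apply HP0|apply HP1]; auto.
      + apply Rabs_mult_le; [|apply HR4; auto].
        apply Rabs_opp_le. apply Rabs_mult_le; [apply Rle_refl|].
        apply Rabs_mult_le; [apply HP0; auto|]. apply Rabs_mult_le; apply HP0; auto. }
  destruct (Hk 0%nat) as [C0 H0], (Hk 1%nat) as [C1 H1], (Hk 2%nat) as [C2 H2],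
    (Hk 3%nat) as [C3 H3].
  exists (Rabs C0 + Rabs C1 + Rabs C2 + Rabs C3).
  assert (A0 := Rabs_pos C0). assert (A1 := Rabs_pos C1).
  assert (A2 := Rabs_pos C2). assert (A3 := Rabs_pos C3).
  assert (L0 := Rle_abs C0). assert (L1 := Rle_abs C1).
  assert (L2 := Rle_abs C2). assert (L3 := Rle_abs C3).
  split; [lra|]. intros k Hk3 X t HX Ht.
  destruct k as [|[|[|[|k]]]]; [| | | |lia].
  - specialize (H0 X t HX Ht). lra.
  - specialize (H1 X t HX Ht). lra.
  - specialize (H2 X t HX Ht). lra.
  - specialize (H3 X t HX Ht). lra.
Qed.

(** With [P] the difference quotient of [x] and [v = d_X x], the flux is built from
    [f0 / P = q * (v / P)].  All three factors have centred expansions, and [v / P] is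
    [1] with vanishing slope; hence the divided difference of [f0 / P], or of its
    inverse, is that of [q], or of its inverse, up to [O(eta ^ 2)]. *)
Lemma flux_consistency : exists C, forall X eta t,
  0 < eta -> a <= X - 2 * eta -> X + 2 * eta <= b -> 0 < t <= T ->
  Rabs ((flux c ((x 0%nat 0%nat (X + 2 * eta) t - x 0%nat 0%nat X t) / (2 * eta)
                 / f0 (X + eta))
         - flux c ((x 0%nat 0%nat X t - x 0%nat 0%nat (X - 2 * eta) t) / (2 * eta)
                   / f0 (X - eta))) / (2 * eta)
        - mobility c m (f0 X) (x 1%nat 0%nat X t) * x 0%nat 1%nat X t)
    <= C * eta ^ 2.
Proof.
  destruct density_jet_bounded as [Bq [HBq0 HBq]].
  set (B0 := Rmax B Bq).
  assert (HB0 : B <= B0) by apply Rmax_l. assert (HB0q : Bq <= B0) by apply Rmax_r.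
  destruct (centred_jet B0) as [B1 HB1].
  destruct (centred_difference_quotient B0) as [B2 HB2].
  destruct (centred_inv B2 beta Hbeta) as [B3 HB3].
  set (B4 := Rmax B1 B3).
  destruct (centred_mult B4) as [B5 HB5].
  set (B6 := Rmax B4 B5).
  destruct (centred_mult B6) as [B7 HB7].
  assert (Hk : 0 < bf / B) by (apply Rdiv_lt_0_compat; lra).
  destruct (centred_inv B7 (bf / B) Hk) as [B8 HB8].
  exists (Rmax B7 B8). intros X eta t He Hl Hr Ht.
  assert (Jq : jet 3 (X - eta) (X + eta) B0 (density_jet t)).
  { split; [|split; [|lra]].
    - intros k Hk3 y Hy. apply is_derive_D_in, density_jet_derive; auto; lra.
    - intros k Hk3 y Hy. eapply Rle_trans; [|exact HB0q]. apply HBq; auto; lra. }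
  assert (Jw : forall n v, jet n a b B v -> jet n a b B0 v).
  { intros n v [E1 [E2 E3]]. split; [exact E1|split; [|lra]].
    intros k Hk3 y Hy. eapply Rle_trans; [|exact HB0]. auto. }
  assert (Cq := HB1 _ _ _ X eta Jq ltac:(lra) ltac:(lra) ltac:(lra)).
  assert (Cv := HB1 _ _ _ X eta (Jw _ _ (jet_x 1 3 t ltac:(lia) ltac:(lra)))
                  ltac:(lra) ltac:(lra) ltac:(lra)).
  assert (CP := HB2 _ _ _ X eta (Jw _ _ (jet_x 0 4 t ltac:(lia) ltac:(lra)))
                  ltac:(lra) ltac:(lra) ltac:(lra)).
  cbn [Nat.add] in Cv, CP.
  assert (Rp := difference_quotient_range X (X + 2 * eta) t
                 ltac:(lra) ltac:(lra) ltac:(lra) ltac:(lra)).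
  assert (Rm := difference_quotient_range (X - 2 * eta) X t
                 ltac:(lra) ltac:(lra) ltac:(lra) ltac:(lra)).
  replace (X + 2 * eta - X) with (2 * eta) in Rp by ring.
  replace (X - (X - 2 * eta)) with (2 * eta) in Rm by ring.
  set (Pp := (x 0%nat 0%nat (X + 2 * eta) t - x 0%nat 0%nat X t) / (2 * eta)) in *.
  set (Pm := (x 0%nat 0%nat X t - x 0%nat 0%nat (X - 2 * eta) t) / (2 * eta)) in *.
  assert (Xr := x10_range X t ltac:(lra) ltac:(lra)).
  assert (Xrp := x10_range (X + eta) t ltac:(lra) ltac:(lra)).
  assert (Xrm := x10_range (X - eta) t ltac:(lra) ltac:(lra)).
  assert (Fp := Hf0 (X + eta) ltac:(lra)). assert (Fm := Hf0 (X - eta) ltac:(lra)).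
  assert (Fx := Hf0 X ltac:(lra)).
  assert (CI := HB3 _ _ _ _ _ CP (proj1 Rp) (proj1 Rm) (proj1 Xr)).
  assert (Crho := HB5 _ _ _ _ _ _ _ _ _
     (centred_weaken _ B4 _ _ _ _ _ (Rmax_l _ _) Cv)
     (centred_weaken _ B4 _ _ _ _ _ (Rmax_r _ _) CI)).
  assert (CF := HB7 _ _ _ _ _ _ _ _ _
     (centred_weaken _ B6 _ _ _ _ _
        (Rle_trans _ _ _ (Rmax_l B1 B3) (Rmax_l _ _)) Cq)
     (centred_weaken _ B6 _ _ _ _ _ (Rmax_r _ _) Crho)).
  cbn [density_jet] in CF. clear Crho CI Cq Cv CP.
  set (Gp := f0 (X + eta) / x 1%nat 0%nat (X + eta) t
             * (x 1%nat 0%nat (X + eta) t * / Pp)) in CF.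
  set (Gm := f0 (X - eta) / x 1%nat 0%nat (X - eta) t
             * (x 1%nat 0%nat (X - eta) t * / Pm)) in CF.
  assert (EGp : Gp = f0 (X + eta) / Pp) by (unfold Gp; field; lra).
  assert (EGm : Gm = f0 (X - eta) / Pm) by (unfold Gm; field; lra).
  set (v := x 1%nat 0%nat X t) in *.
  replace (f0 X / v * (v * / v)) with (f0 X / v) in CF by (field; lra).
  match type of CF with centred _ _ _ _ _ ?g1 =>
    replace g1 with (- p0 X t * Rpower (f0 X / v) (2 - m)) in CF by (field; lra) end.
  assert (Hlow : forall f P, bf <= f -> beta <= P <= B -> bf / B <= f / P).
  { intros f P Hf HP. unfold Rdiv. apply Rmult_le_compat; try lra.
    - apply Rlt_le, Rinv_0_lt_compat; lra.
    - apply Rinv_le_contravar; lra. }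
  assert (HQ : 0 < f0 X / v) by (apply Rdiv_lt_0_compat; lra).
  assert (He2 := pow2_ge_0 eta).
  destruct c; cbn [flux].
  - replace (- / (Pp / f0 (X + eta))) with (- Gp) by (rewrite EGp; field; lra).
    replace (- / (Pm / f0 (X - eta))) with (- Gm) by (rewrite EGm; field; lra).
    destruct CF as [_ [_ [CF _]]].
    replace (_ - _) with
      (- ((Gp - Gm) / (2 * eta) - - p0 X t * Rpower (f0 X / v) (2 - m))).
    { apply Rabs_opp_le. eapply Rle_trans; [exact CF|].
      apply Rmult_le_compat_r; [lra|apply Rmax_l]. }
    unfold mobility, p0. fold v.
    replace (v / f0 X) with (/ (f0 X / v)) by (field; lra).
    rewrite Rpower_Rinv by exact HQ.
    replace (2 - m) with (1 + - (m - 1)) by ring.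
    rewrite Rpower_plus, Rpower_Ropp, Rpower_1 by exact HQ.
    assert (H := Rpower_pos (f0 X / v) (m - 1)). field. lra.
  - apply HB8 in CF; [|rewrite EGp; apply Hlow; lra|rewrite EGm; apply Hlow; lra
                      |apply Hlow; lra].
    replace (Pp / f0 (X + eta)) with (/ Gp) by (rewrite EGp; field; lra).
    replace (Pm / f0 (X - eta)) with (/ Gm) by (rewrite EGm; field; lra).
    destruct CF as [_ [_ [CF _]]].
    match type of CF with Rabs (_ - ?g) <= _ =>
      replace g with (mobility Case2 m (f0 X) v * x 0%nat 1%nat X t) in CF end.
    { eapply Rle_trans; [exact CF|].
      apply Rmult_le_compat_r; [lra|apply Rmax_r]. }
    unfold mobility, p0. fold v.
    replace (v / f0 X) with (/ (f0 X / v)) by (field; lra).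
    rewrite Rpower_Rinv by exact HQ.
    replace (m + 1) with (- (2 - m) + 3) by ring.
    rewrite Rpower_plus, Rpower_Ropp.
    assert (E3 : Rpower (f0 X / v) 3 = (f0 X / v) ^ 3).
    { rewrite <- (Rpower_pow 3) by exact HQ. f_equal. simpl. ring. }
    rewrite E3.
    assert (H := Rpower_pos (f0 X / v) (2 - m)).
    field. repeat split; lra.
Qed.

Lemma difference_quotient_time_variation Y Z t t' :
  a <= Y -> Y < Z -> Z <= b -> 0 <= t <= t' -> t' <= T ->
  Rabs ((x 0%nat 0%nat Z t' - x 0%nat 0%nat Y t') / (Z - Y)
        - (x 0%nat 0%nat Z t - x 0%nat 0%nat Y t) / (Z - Y)) <= B * (t' - t).
Proof.
  intros HY HYZ HZ Ht Ht'.
  destruct (mean_value_D_in (fun Y => x 0%nat 0%nat Y t' - x 0%nat 0%nat Y t)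
     (fun Y => x 1%nat 0%nat Y t' - x 1%nat 0%nat Y t) a b Y Z)
    as [w [Hw [_ Hmv]]]; try lra.
  { intros w Hw.
    apply (Dminus _ (fun Y => x 1%nat 0%nat Y t') (fun Y => x 1%nat 0%nat Y t)
             (fun Y => x 0%nat 0%nat Y t') (fun Y => x 0%nat 0%nat Y t));
      apply Hx_X; auto; try lia; lra. }
  replace (_ - _) with (x 1%nat 0%nat w t' - x 1%nat 0%nat w t).
  2: { apply Rmult_eq_reg_r with (Z - Y); [|lra]. rewrite <- Hmv. field. lra. }
  destruct (mean_value_D_in (fun s => x 1%nat 0%nat w s) (fun s => x 1%nat 1%nat w s)
     0 T t t') as [s [Hs [_ ->]]]; try lra.
  { intros s Hs. apply Hx_t; auto; lia. }
  rewrite Rabs_mult, (Rabs_pos_eq (t' - t)) by lra.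
  apply Rmult_le_compat_r; [lra|]. apply HB; auto; lia.
Qed.

Lemma x10_time_variation X t t' : a <= X <= b -> 0 <= t <= t' -> t' <= T ->
  Rabs (x 1%nat 0%nat X t - x 1%nat 0%nat X t') <= B * (t' - t).
Proof.
  intros HX Ht Ht'.
  destruct (mean_value_D_in (fun s => x 1%nat 0%nat X s) (fun s => x 1%nat 1%nat X s)
     0 T t' t) as [s [Hs [_ ->]]]; try lra.
  { intros s Hs. apply Hx_t; auto; lia. }
  rewrite Rabs_mult, (Rabs_minus_sym t), (Rabs_pos_eq (t' - t)) by lra.
  apply Rmult_le_compat_r; [lra|]. apply HB; auto; lia.
Qed.

Lemma backward_velocity X t t' : a <= X <= b -> 0 <= t < t' -> t' <= T ->
  Rabs ((x 0%nat 0%nat X t' - x 0%nat 0%nat X t) / (t' - t)) <= B /\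
  Rabs ((x 0%nat 0%nat X t' - x 0%nat 0%nat X t) / (t' - t) - x 0%nat 1%nat X t')
    <= B * (t' - t).
Proof.
  intros HX Ht Ht'.
  assert (J : jet 2 0 T B (fun k s => x 0%nat k X s)).
  { split; [|split; [|lra]].
    - intros k Hk s Hs. apply Hx_t; auto; lia.
    - intros k Hk s Hs. apply HB; auto; lia. }
  split.
  - destruct (mean_value_D_in (fun s => x 0%nat 0%nat X s) (fun s => x 0%nat 1%nat X s)
      0 T t t') as [s [Hs [_ ->]]]; try lra.
    { intros s Hs. apply Hx_t; auto; lia. }
    replace (_ / _) with (x 0%nat 1%nat X s) by (field; lra).
    apply HB; auto; lia.
  - assert (H := taylor2 _ _ _ _ J t' t ltac:(lra) ltac:(lra)). cbv beta in H.
    rewrite (Rabs_minus_sym t), (Rabs_pos_eq (t' - t)) in H by lra.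
    replace (_ - _) with
      (- (x 0%nat 0%nat X t - (x 0%nat 0%nat X t' + x 0%nat 1%nat X t' * (t - t')))
       * / (t' - t)) by (field; lra).
    rewrite Rabs_mult, Rabs_Ropp, (Rabs_pos_eq (/ _))
      by (apply Rlt_le, Rinv_0_lt_compat; lra).
    apply Rmult_le_reg_r with (t' - t); [lra|].
    rewrite Rmult_assoc, Rinv_l, Rmult_1_r by lra. lra.
Qed.

Section Grid.

Variable M : nat.
Hypothesis HM : (2 <= M)%nat.
Let h := step a b M.

Lemma INR_M_pos : 0 < INR M.
Proof. apply lt_0_INR. lia. Qed.

Lemma step_pos : 0 < h.
Proof. apply Rdiv_lt_0_compat; [lra|apply INR_M_pos]. Qed.

Lemma step_mult : h * INR M = b - a.
Proof. unfold h, step. assert (H := INR_M_pos). field. lra. Qed.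

Lemma step_le : h <= b - a.
Proof.
  rewrite <- step_mult. assert (H := step_pos).
  assert (1 <= INR M) by (apply (le_INR 1); lia). nra.
Qed.

Lemma node_S i : node a b M (i + 1) = node a b M i + h.
Proof. unfold node, h. rewrite plus_INR. simpl (INR 1). ring. Qed.

Lemma node_pred i : (1 <= i)%nat -> node a b M (i - 1) = node a b M i - h.
Proof.
  intros Hi. replace i with (i - 1 + 1)%nat at 2 by lia. rewrite node_S. ring.
Qed.

Lemma node_0 : node a b M 0 = a.
Proof. unfold node. simpl. ring. Qed.

Lemma node_M : node a b M M = b.
Proof. unfold node. rewrite Rmult_comm. fold h. rewrite step_mult. ring. Qed.

Lemma node_range i : (i <= M)%nat -> a <= node a b M i <= b.
Proof.
  intros Hi. assert (E := node_M). unfold node in *. fold h in E |- *.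
  assert (H := step_pos). assert (H0 := pos_INR i). apply le_INR in Hi. split; nra.
Qed.

Lemma half_node_S i : half_node a b M (i + 1) = node a b M i + h / 2.
Proof. unfold half_node, node, h. rewrite plus_INR. simpl (INR 1). field. Qed.

Lemma half_node_eq i : half_node a b M i = node a b M i - h / 2.
Proof. unfold half_node, node, h. field. Qed.

Lemma node_interior_range i : (1 <= i <= M - 1)%nat ->
  a <= node a b M i - h /\ node a b M i + h <= b.
Proof.
  intros Hi. rewrite <- node_pred, <- node_S by lia. split; apply node_range; lia.
Qed.

Lemma half_node_range j : (1 <= j <= M)%nat -> a < half_node a b M j < b.
Proof.
  intros Hj. rewrite half_node_eq. assert (H := step_pos).
  assert (H1 := node_range j ltac:(lia)).
  assert (H2 := node_range (j - 1) ltac:(lia)). rewrite node_pred in H2 by lia. lra.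
Qed.

Lemma D_h_range t j : 0 <= t <= T -> (1 <= j <= M)%nat ->
  beta <= D_h h (fun i => x 0%nat 0%nat (node a b M i) t) j <= B.
Proof.
  intros Ht Hj. assert (H := step_pos). unfold D_h. rewrite node_pred by lia.
  assert (H1 := node_range j ltac:(lia)).
  assert (H2 := node_range (j - 1) ltac:(lia)). rewrite node_pred in H2 by lia.
  assert (E := difference_quotient_range (node a b M j - h) (node a b M j) t
     ltac:(lra) ltac:(lra) ltac:(lra) Ht).
  replace (node a b M j - (node a b M j - h)) with h in E by ring. exact E.
Qed.

Lemma D_h_time_variation t t' j : 0 <= t <= t' -> t' <= T -> (1 <= j <= M)%nat ->
  Rabs (D_h h (fun i => x 0%nat 0%nat (node a b M i) t') j
        - D_h h (fun i => x 0%nat 0%nat (node a b M i) t) j) <= B * (t' - t).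
Proof.
  intros Ht Ht' Hj. assert (H := step_pos). unfold D_h. rewrite node_pred by lia.
  assert (H1 := node_range j ltac:(lia)).
  assert (H2 := node_range (j - 1) ltac:(lia)). rewrite node_pred in H2 by lia.
  assert (E := difference_quotient_time_variation (node a b M j - h) (node a b M j) t t'
     ltac:(lra) ltac:(lra) ltac:(lra) Ht Ht').
  replace (node a b M j - (node a b M j - h)) with h in E by ring. exact E.
Qed.

End Grid.

(** Symmetric differences inside; at the ends the three-point formula cancels the
    second derivative. *)
Lemma Dt_h_consistency : exists C, 0 <= C /\ forall M t i,
  (2 <= M)%nat -> 0 <= t <= T -> (i <= M)%nat ->
  Rabs (Dt_h (step a b M) M (fun i => x 0%nat 0%nat (node a b M i) t) i
        - x 1%nat 0%nat (node a b M i) t) <= C * step a b M ^ 2.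
Proof.
  destruct (centred_jet B) as [B1 HB1]. exists (Rmax B1 (6 * B)).
  split. { eapply Rle_trans; [|apply Rmax_r]; lra. }
  intros M t i HM Ht Hi.
  assert (Hh := step_pos M HM). assert (Hh2 := step_le M HM).
  assert (Hsq := pow2_ge_0 (step a b M)).
  assert (J := jet_x 0 3 t ltac:(lia) Ht). cbn [Nat.add] in J.
  assert (H3 : forall d e, Rabs d <= B * step a b M ^ 3 ->
            Rabs e <= B * (2 * step a b M) ^ 3 ->
            Rabs ((4 * d - e) / (2 * step a b M)) <= 6 * B * step a b M ^ 2).
  { intros d e Hd He. unfold Rdiv. rewrite Rabs_mult, (Rabs_pos_eq (/ _))
      by (apply Rlt_le, Rinv_0_lt_compat; lra).
    apply Rmult_le_reg_r with (2 * step a b M); [lra|].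
    rewrite Rmult_assoc, Rinv_l, Rmult_1_r by lra.
    apply Rabs_le_between in Hd. apply Rabs_le_between in He. apply Rabs_le.
    nra. }
  unfold Dt_h. destruct (Nat.eqb_spec i 0) as [->|Hi0].
  - eapply Rle_trans; [|apply Rmult_le_compat_r; [exact Hsq|apply Rmax_r]].
    assert (N1 : node a b M 1 = a + step a b M).
    { replace 1%nat with (0 + 1)%nat by lia. rewrite node_S, node_0; auto. }
    assert (N2 : node a b M 2 = a + 2 * step a b M).
    { replace 2%nat with (1 + 1)%nat by lia. rewrite node_S, N1. ring. }
    assert (R2 := node_range M HM 2 ltac:(lia)).
    rewrite N1, node_0, N2 in *.
    assert (T1 := taylor3 _ _ _ _ J a (a + step a b M) ltac:(lra) ltac:(lra)).
    assert (T2 := taylor3 _ _ _ _ J a (a + 2 * step a b M) ltac:(lra) ltac:(lra)).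
    replace (a + step a b M - a) with (step a b M) in T1 by ring.
    replace (a + 2 * step a b M - a) with (2 * step a b M) in T2 by ring.
    rewrite (Rabs_pos_eq (step a b M)) in T1 by lra.
    rewrite (Rabs_pos_eq (2 * step a b M)) in T2 by lra.
    assert (H := H3 _ _ T1 T2). cbv beta in H.
    eapply Rle_trans; [apply Req_le|exact H]. f_equal. field. lra.
  - destruct (Nat.eqb_spec i M) as [->|HiM].
    + eapply Rle_trans; [|apply Rmult_le_compat_r; [exact Hsq|apply Rmax_r]].
      assert (N1 : node a b M (M - 1) = b - step a b M).
      { rewrite node_pred, node_M; auto; lia. }
      assert (N2 : node a b M (M - 2) = b - 2 * step a b M).
      { replace (M - 2)%nat with (M - 1 - 1)%nat by lia.
        rewrite node_pred, N1 by lia. ring. }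
      assert (R2 := node_range M HM (M - 2) ltac:(lia)).
      rewrite N1, node_M, N2 in * by exact HM.
      assert (T1 := taylor3 _ _ _ _ J b (b - step a b M) ltac:(lra) ltac:(lra)).
      assert (T2 := taylor3 _ _ _ _ J b (b - 2 * step a b M) ltac:(lra) ltac:(lra)).
      replace (b - step a b M - b) with (- step a b M) in T1 by ring.
      replace (b - 2 * step a b M - b) with (- (2 * step a b M)) in T2 by ring.
      rewrite Rabs_Ropp, (Rabs_pos_eq (step a b M)) in T1 by lra.
      rewrite Rabs_Ropp, (Rabs_pos_eq (2 * step a b M)) in T2 by lra.
      assert (H := H3 _ _ T1 T2). cbv beta in H. rewrite <- Rabs_Ropp in H.
      eapply Rle_trans; [apply Req_le|exact H]. f_equal. field. lra.
    + eapply Rle_trans; [|apply Rmult_le_compat_r; [exact Hsq|apply Rmax_l]].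
      assert (R := node_interior_range M HM i ltac:(lia)).
      rewrite node_S, node_pred by lia.
      destruct (HB1 _ _ _ (node a b M i) (step a b M) J ltac:(lra) ltac:(lra) ltac:(lra))
        as [_ [_ [H _]]]. exact H.
Qed.

Let Bf_ge : bf <= Bf.
Proof. assert (H := Hf0 a ltac:(lra)). lra. Qed.

Lemma beta_le_B : beta <= B.
Proof. assert (H := x10_range a 0 ltac:(lra) ltac:(lra)). lra. Qed.

(** The expansion is about the new time level [t']: the fluxes are implicit, and the
    trajectory equation holds for positive times only.  The mobility, taken at the old
    level, is Lipschitz and costs [O(tau)]. *)
Lemma truncation_error : exists C, 0 <= C /\ forall M t t' i,
  (2 <= M)%nat -> 0 <= t < t' -> t' <= T -> (1 <= i <= M - 1)%nat ->
  let h := step a b M in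
  let u := fun i => x 0%nat 0%nat (node a b M i) t in
  let u' := fun i => x 0%nat 0%nat (node a b M i) t' in
  Rabs (mobility c m (f0 (node a b M i)) (Dt_h h M u i) * ((u' i - u i) / (t' - t))
        - (flux c (D_h h u' (i + 1) / f0 (half_node a b M (i + 1)))
           - flux c (D_h h u' i / f0 (half_node a b M i))) / h)
    <= C * (t' - t + h ^ 2).
Proof.
  destruct flux_consistency as [C1 HC1].
  destruct Dt_h_consistency as [C2 [HC20 HC2]].
  destruct (mobility_bounds c m bf Bf beta B ltac:(lra) (conj Hbf Bf_ge)
              (conj Hbeta beta_le_B)) as [al [A [L [Hal [HL Hmob]]]]].
  exists (L * (C2 + B) * B + Rabs A * B + Rabs C1).
  assert (HA := Rabs_pos A). assert (HC := Rabs_pos C1).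
  assert (P1 : 0 <= L * C2) by (apply Rmult_le_pos; lra).
  assert (P2 : 0 <= L * B) by (apply Rmult_le_pos; lra).
  assert (P3 : 0 <= L * C2 * B) by (apply Rmult_le_pos; lra).
  assert (P4 : 0 <= L * B * B) by (apply Rmult_le_pos; lra).
  assert (P5 : 0 <= Rabs A * B) by (apply Rmult_le_pos; lra).
  split; [lra|].
  intros M t t' i HM Ht Ht' Hi h u u'.
  assert (Hh := step_pos M HM). fold h in Hh.
  assert (R := node_interior_range M HM i Hi). fold h in R.
  assert (RX := node_range M HM i ltac:(lia)).
  specialize (HC2 M t i HM ltac:(lra) ltac:(lia)). fold h u in HC2.
  assert (HDt : beta <= Dt_h h M u i <= B).
  { rewrite Dt_h_interior by (auto; lra).
    assert (X1 := D_h_range M HM t i ltac:(lra) ltac:(lia)).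
    assert (X2 := D_h_range M HM t (i + 1) ltac:(lra) ltac:(lia)).
    fold h u in X1, X2. lra. }
  destruct (backward_velocity (node a b M i) t t' RX Ht Ht') as [V1 V2].
  fold (u i) (u' i) in V1, V2.
  assert (HC1' := HC1 (node a b M i) (h / 2) t' ltac:(lra) ltac:(lra) ltac:(lra) ltac:(lra)).
  replace (2 * (h / 2)) with h in HC1' by field.
  unfold D_h at 1 2. rewrite Nat.add_sub, half_node_S, half_node_eq.
  fold h. unfold u' at 2 3 4 5. rewrite node_S, node_pred by lia. fold h.
  set (X := node a b M i) in *.
  set (F := (flux c _ - flux c _) / h) in *.
  set (p' := x 1%nat 0%nat X t') in *.
  assert (Hp' : beta <= p' <= B) by (apply x10_range; lra).
  destruct (Hmob (f0 X) (Dt_h h M u i) p' (Hf0 X RX) HDt Hp') as [_ Hl].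
  destruct (Hmob (f0 X) p' p' (Hf0 X RX) Hp' Hp') as [[Ha1 Ha2] _].
  assert (HpA : Rabs (mobility c m (f0 X) p') <= Rabs A).
  { rewrite Rabs_pos_eq by lra. eapply Rle_trans; [exact Ha2|apply Rle_abs]. }
  assert (Hx := x10_time_variation X t t' RX ltac:(lra) Ht'). fold p' in Hx.
  assert (HD : Rabs (Dt_h h M u i - p') <= C2 * h ^ 2 + B * (t' - t)).
  { replace (Dt_h h M u i - p') with
      ((Dt_h h M u i - x 1%nat 0%nat X t) + (x 1%nat 0%nat X t - p')) by ring.
    apply Rabs_plus_le; assumption. }
  set (q := (u' i - u i) / (t' - t)) in *.
  set (mu := mobility c m (f0 X) (Dt_h h M u i)) in *.
  set (mu' := mobility c m (f0 X) p') in *.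
  replace (mu * q - F) with
    ((mu - mu') * q + mu' * (q - x 0%nat 1%nat X t')
     + - (F - mu' * x 0%nat 1%nat X t')) by ring.
  assert (Hh2 := pow2_ge_0 h).
  eapply Rle_trans.
  { apply Rabs_plus_le; [apply Rabs_plus_le; apply Rabs_mult_le|apply Rabs_opp_le].
    - eapply Rle_trans; [exact Hl|]. apply Rmult_le_compat_l; [exact HL|exact HD].
    - exact V1.
    - exact HpA.
    - exact V2.
    - exact HC1'. }
  assert (C1 * (h / 2) ^ 2 <= Rabs C1 * h ^ 2).
  { apply Rle_trans with (Rabs C1 * (h / 2) ^ 2).
    - apply Rmult_le_compat_r; [apply pow2_ge_0|apply Rle_abs].
    - apply Rmult_le_compat_l; [exact HC|]. nra. }
  assert (0 <= t' - t) by lra.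
  assert (0 <= L * C2 * B * (t' - t)) by (apply Rmult_le_pos; lra).
  assert (0 <= L * B * B * h ^ 2) by (apply Rmult_le_pos; lra).
  assert (0 <= Rabs A * B * h ^ 2) by (apply Rmult_le_pos; lra).
  assert (0 <= Rabs C1 * (t' - t)) by (apply Rmult_le_pos; lra).
  lra.
Qed.

(** * Convergence *)

(** Common bounds on the gradients of the exact and the numerical solution. *)
Let glo := Rmin beta (bf / Bf).
Let ghi := Rmax B (Bf / bf).

Lemma glo_ghi : 0 < glo <= beta /\ glo <= bf / Bf /\ B <= ghi /\ Bf / bf <= ghi /\ glo <= ghi.
Proof.
  assert (H1 : 0 < bf / Bf) by (apply Rdiv_lt_0_compat; lra).
  assert (H2 := Rmin_l beta (bf / Bf)). assert (H3 := Rmin_r beta (bf / Bf)).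
  assert (H4 := Rmax_l B (Bf / bf)). assert (H5 := Rmax_r B (Bf / bf)).
  assert (H6 := beta_le_B). fold glo in H2, H3. fold ghi in H4, H5.
  assert (0 < glo) by (unfold glo; apply Rmin_case; lra). lra.
Qed.

Section NumericalSolution.

Variables (N M : nat) (xh : nat -> nat -> R).
Hypothesis HN : (1 <= N)%nat.
Hypothesis HM : (2 <= M)%nat.
Hypothesis Hnum : numerical_solution c a b T m f0 N M xh.
Let h := step a b M.
Let tau := T / INR N.

Lemma tau_pos : 0 < tau.
Proof. apply Rdiv_lt_0_compat; [exact HT|]. apply lt_0_INR. exact HN. Qed.

Lemma time_range n : (n <= N)%nat -> 0 <= INR n * tau <= T.
Proof.
  intros Hn. assert (H := tau_pos). assert (H0 := pos_INR n). apply le_INR in Hn.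
  assert (E : INR N * tau = T).
  { unfold tau. field. apply Rgt_not_eq, lt_0_INR. exact HN. }
  split; nra.
Qed.

Lemma numerical_D_h_pos n j : (n <= N)%nat -> (1 <= j <= M)%nat -> 0 < D_h h (xh n) j.
Proof.
  intros Hn Hj. destruct Hnum as [HQ _]. destruct (HQ n Hn) as [Hinc _].
  specialize (Hinc j Hj). apply Rdiv_lt_0_compat; [lra|apply (step_pos M HM)].
Qed.

Lemma numerical_implicit_step n : (n < N)%nat ->
  implicit_step c M h tau
    (fun i => mobility c m (f0 (node a b M i)) (Dt_h h M (xh n) i))
    (fun j => f0 (half_node a b M j)) (xh n) (xh (S n)).
Proof.
  intros Hn. destruct Hnum as [HQ [_ Hs]].
  destruct (Hs n Hn) as [Hsch [E0 EM]].
  destruct (HQ n ltac:(lia)) as [_ [F0 FM]].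
  split; [|split; lra].
  intros i Hi. specialize (Hsch i Hi).
  assert (Hh := step_pos M HM). fold h in Hh.
  assert (R := Hf0 (node a b M i) (node_range M HM i ltac:(lia))).
  assert (HDt : 0 < Dt_h h M (xh n) i).
  { rewrite Dt_h_interior by (auto; lra).
    assert (X1 := numerical_D_h_pos n i ltac:(lia) ltac:(lia)).
    assert (X2 := numerical_D_h_pos n (i + 1) ltac:(lia) ltac:(lia)). lra. }
  assert (X1 := numerical_D_h_pos (S n) i ltac:(lia) ltac:(lia)).
  assert (X2 := numerical_D_h_pos (S n) (i + 1) ltac:(lia) ltac:(lia)).
  assert (R1 := half_node_range M HM i ltac:(lia)).
  assert (R2 := half_node_range M HM (i + 1) ltac:(lia)).
  assert (G1 := Hf0 (half_node a b M i) ltac:(lra)).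
  assert (G2 := Hf0 (half_node a b M (i + 1)) ltac:(lra)).
  revert Hsch. unfold scheme_equation, d_h. fold h tau.
  destruct c; cbn [flux].
  - rewrite mobility_Case1 by lra. intros ->. field. repeat split; lra.
  - rewrite mobility_Case2 by lra. intros ->. reflexivity.
Qed.

Lemma numerical_density_range n : (n <= N)%nat -> forall j, (1 <= j <= M)%nat ->
  / Bf <= D_h h (xh n) j / f0 (half_node a b M j) <= / bf.
Proof.
  assert (Hh := step_pos M HM). fold h in Hh.
  assert (Hphi : forall j, (1 <= j <= M)%nat -> bf <= f0 (half_node a b M j) <= Bf).
  { intros j Hj. apply Hf0. assert (R := half_node_range M HM j Hj). lra. }
  induction n as [|n IH]; intros Hn j Hj.
  - destruct Hnum as [_ [H0 _]]. unfold D_h. rewrite !H0, node_pred by lia. fold h.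
    replace (_ / h) with 1 by (field; lra). specialize (Hphi j Hj).
    unfold Rdiv. rewrite Rmult_1_l. split; apply Rinv_le_contravar; lra.
  - apply (implicit_step_maximum_principle c M h tau
      (fun i => mobility c m (f0 (node a b M i)) (Dt_h h M (xh n) i))
      (fun j => f0 (half_node a b M j)) (xh n) (xh (S n))); auto; try lia.
    + apply tau_pos.
    + intros i Hi. assert (R := Hf0 (node a b M i) (node_range M HM i ltac:(lia))).
      unfold mobility. apply Rmult_lt_0_compat; [|apply Rpower_pos].
      apply Rdiv_lt_0_compat; lra.
    + intros k Hk. specialize (Hphi k Hk). lra.
    + intros k Hk. apply numerical_D_h_pos; auto.
    + apply numerical_implicit_step. lia.
    + apply IH. lia.
Qed.

Lemma numerical_gradient_in n : (n <= N)%nat -> gradient_in h M glo ghi (xh n).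
Proof.
  intros Hn j Hj. assert (G := glo_ghi).
  assert (H := numerical_density_range n Hn j Hj).
  assert (R := half_node_range M HM j Hj).
  assert (F := Hf0 (half_node a b M j) ltac:(lra)).
  set (f := f0 (half_node a b M j)) in *. set (d := D_h h (xh n) j) in *.
  replace d with (d / f * f) by (field; lra).
  assert (0 < / Bf) by (apply Rinv_0_lt_compat; lra).
  assert (bf / Bf <= d / f * f <= Bf / bf); [|lra].
  unfold Rdiv at 1 4. rewrite (Rmult_comm bf), (Rmult_comm Bf).
  split; apply Rmult_le_compat; lra.
Qed.

Lemma exact_gradient_in t : 0 <= t <= T ->
  gradient_in h M glo ghi (fun i => x 0%nat 0%nat (node a b M i) t).
Proof.
  intros Ht j Hj. assert (G := glo_ghi).
  assert (H := D_h_range M HM t j Ht Hj). fold h in H. lra.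
Qed.

End NumericalSolution.

Definition error (N M : nat) (xh : nat -> nat -> R) (n i : nat) : R :=
  x 0%nat 0%nat (node a b M i) (INR n * (T / INR N)) - xh n i.

Lemma D_h_error N M xh h n j : h <> 0 ->
  D_h h (error N M xh n) j
  = D_h h (fun i => x 0%nat 0%nat (node a b M i) (INR n * (T / INR N))) j
    - D_h h (xh n) j.
Proof. intros Hh. unfold D_h, error. field. exact Hh. Qed.

(** Gronwall's inequality for the relative energy, which vanishes initially.  Moving
    the exact gradient must keep the numerical one positive, hence the restriction
    [B * tau <= glo / 2]; a larger [tau] is bounded below, and then the bounds on the
    gradients suffice. *)
Lemma gradient_error : exists C, 0 <= C /\ forall N M xh,
  (1 <= N)%nat -> (2 <= M)%nat -> numerical_solution c a b T m f0 N M xh ->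
  forall n, (n <= N)%nat ->
  step a b M * ssum (fun j => D_h (step a b M) (error N M xh n) j ^ 2) M
    <= C * (T / INR N + step a b M ^ 2) ^ 2.
Proof.
  assert (Hg := glo_ghi).
  destruct truncation_error as [C1 [HC1 Htr]].
  destruct (energy_step c m bf Bf glo ghi B B (b - a) ltac:(lra)
    (conj Hbf Bf_ge) ltac:(lra) ltac:(lra) ltac:(lra) ltac:(lra)) as [K [HK Hen]].
  destruct (relative_energy_coercive c bf Bf glo ghi (conj Hbf Bf_ge) ltac:(lra))
    as [k [Hk Hco]].
  set (D1 := exp (K * T) * C1 ^ 2 / k). set (D2 := (b - a) * ghi ^ 2 * (2 * B / glo) ^ 2).
  assert (HD1 : 0 <= D1).
  { unfold D1. apply Rmult_le_pos; [|apply Rlt_le, Rinv_0_lt_compat; lra].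
    apply Rmult_le_pos; [apply Rlt_le, exp_pos|apply pow2_ge_0]. }
  assert (HD2 : 0 <= D2).
  { unfold D2. apply Rmult_le_pos; [|apply pow2_ge_0].
    apply Rmult_le_pos; [lra|apply pow2_ge_0]. }
  exists (D1 + D2). split; [lra|].
  intros N M xh HN HM Hnum n Hn.
  assert (Hh := step_pos M HM). assert (Htau := tau_pos N HN).
  set (h := step a b M) in *. set (tau := T / INR N) in *.
  assert (Hh2 := pow2_ge_0 h).
  set (ue := fun n i => x 0%nat 0%nat (node a b M i) (INR n * tau)).
  assert (Gw := fun n => numerical_gradient_in N M xh HN HM Hnum n).
  assert (Gu : forall n, (n <= N)%nat -> gradient_in h M glo ghi (ue n)).
  { intros k' Hk'. apply exact_gradient_in; auto. apply time_range; auto. }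
  fold h in Gw.
  rewrite (ssum_ext _ (fun j => (D_h h (ue n) j - D_h h (xh n) j) ^ 2)).
  2: { intros j Hj. rewrite D_h_error by lra. reflexivity. }
  set (S2 := ssum _ M).
  set (eps := tau + h ^ 2).
  assert (Heps : 0 < eps) by (unfold eps; lra).
  assert (Heps2 := pow2_ge_0 eps).
  destruct (Rle_dec (B * tau) (glo / 2)) as [Hsmall|Hlarge].
  - set (G := fun n => total_relative_energy c h M (fun j => f0 (half_node a b M j))
                         (ue n) (xh n)).
    assert (HG : G n <= exp (K * (INR n * tau)) * (C1 * eps) ^ 2).
    { apply (discrete_gronwall G K tau ((C1 * eps) ^ 2) N); auto.
      - apply pow2_ge_0.
      - unfold G, total_relative_energy.
        rewrite (ssum_ext _ (fun _ => 0)); [rewrite ssum_const; ring|].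
        intros j Hj. replace (D_h h (ue 0%nat) j - D_h h (xh 0%nat) j) with 0.
        { apply relative_energy_0. assert (X := Gu 0%nat ltac:(lia) j Hj). lra. }
        destruct Hnum as [_ [H0 _]]. unfold D_h, ue. simpl INR. rewrite Rmult_0_l.
        rewrite !H0 by lia. rewrite !Hinit by (apply node_range; auto; lia).
        field. lra.
      - intros k' Hk'. unfold G.
        assert (R0 := time_range N HN k' ltac:(lia)).
        assert (R1 := time_range N HN (S k') ltac:(lia)). fold tau in R0, R1.
        assert (Et : INR (S k') * tau - INR k' * tau = tau) by (rewrite S_INR; ring).
        destruct (Hends _ R0) as [A0 A1]. destruct (Hends _ R1) as [A0' A1'].
        assert (HQ := proj1 Hnum).
        destruct (HQ k' ltac:(lia)) as [_ [W0 W1]].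
        destruct (HQ (S k') ltac:(lia)) as [_ [W0' W1']].
        apply (Hen M h tau (fun i => f0 (node a b M i))); auto.
        + unfold h. rewrite (step_mult M HM). lra.
        + intros i Hi. apply Hf0, node_range; auto; lia.
        + intros j Hj. apply Hf0. assert (R := half_node_range M HM j Hj). lra.
        + apply Gu; lia.
        + apply Gw; lia.
        + intros j Hj. rewrite <- Et. apply (D_h_time_variation M HM); lra || auto.
        + unfold ue. rewrite node_0. lra.
        + unfold ue. rewrite node_M by exact HM. lra.
        + unfold ue. rewrite node_0. lra.
        + unfold ue. rewrite node_M by exact HM. lra.
        + apply (numerical_implicit_step N M xh HN HM Hnum); exact Hk'.
        + intros i Hi. rewrite <- Et.
          apply (backward_velocity (node a b M i)); try lra.
          apply node_range; auto; lia.
        + intros i Hi.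
          assert (Htr' := Htr M (INR k' * tau) (INR (S k') * tau) i HM
                    ltac:(lra) ltac:(lra) Hi).
          cbv zeta in Htr'. rewrite Et in Htr'. exact Htr'. }
    assert (HkS : k * (h * S2) <= G n).
    { unfold G, total_relative_energy, S2.
      replace (k * (h * _)) with (h * (k * ssum (fun j => (D_h h (ue n) j - D_h h (xh n) j) ^ 2) M))
        by ring.
      apply Rmult_le_compat_l; [lra|]. rewrite <- ssum_scal. apply ssum_le.
      intros j Hj. apply Hco.
      - apply Hf0. assert (R := half_node_range M HM j Hj). lra.
      - apply Gu; auto.
      - replace (_ - _) with (D_h h (xh n) j) by ring. apply Gw; auto. }
    assert (Hexp : exp (K * (INR n * tau)) <= exp (K * T)).
    { assert (R := time_range N HN n Hn). fold tau in R.
      assert (HKT : K * (INR n * tau) <= K * T) by (apply Rmult_le_compat_l; lra).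
      destruct HKT as [Hlt|Heq']; [left; apply exp_increasing, Hlt|rewrite Heq'; lra]. }
    assert (HkS2 : k * (h * S2) <= exp (K * T) * C1 ^ 2 * eps ^ 2).
    { eapply Rle_trans; [exact HkS|]. eapply Rle_trans; [exact HG|].
      rewrite Rpow_mult_distr, Rmult_assoc. apply Rmult_le_compat_r; [|exact Hexp].
      apply Rmult_le_pos; apply pow2_ge_0. }
    assert (HS : h * S2 <= D1 * eps ^ 2).
    { apply Rmult_le_reg_l with k; [lra|]. eapply Rle_trans; [exact HkS2|].
      apply Req_le. unfold D1. field. lra. }
    assert (0 <= D2 * eps ^ 2) by (apply Rmult_le_pos; lra). lra.
  - assert (HS : S2 <= INR M * ghi ^ 2).
    { unfold S2. rewrite <- ssum_const. apply ssum_le. intros j Hj.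
      assert (X1 := Gu n Hn j Hj). assert (X2 := Gw n Hn j Hj).
      rewrite <- (pow2_abs (_ - _)). apply pow_incr. split; [apply Rabs_pos|].
      apply Rabs_le. lra. }
    assert (HhS : h * S2 <= (b - a) * ghi ^ 2).
    { rewrite <- (step_mult M HM). fold h. rewrite Rmult_assoc.
      apply Rmult_le_compat_l; lra. }
    assert (H1 : 1 <= 2 * B / glo * eps).
    { apply Rmult_le_reg_l with glo; [lra|].
      replace (glo * (2 * B / glo * eps)) with (2 * (B * eps)) by (field; lra).
      assert (B * tau <= B * eps) by (apply Rmult_le_compat_l; unfold eps; lra). lra. }
    assert (H2 : 1 <= (2 * B / glo) ^ 2 * eps ^ 2).
    { rewrite <- Rpow_mult_distr. replace 1 with (1 ^ 2) by ring. apply pow_incr. lra. }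
    assert (H3 : (b - a) * ghi ^ 2 <= D2 * eps ^ 2).
    { unfold D2. rewrite (Rmult_assoc _ ((2 * B / glo) ^ 2)).
      rewrite <- (Rmult_1_r ((b - a) * ghi ^ 2)) at 1.
      apply Rmult_le_compat_l; [|lra]. apply Rmult_le_pos; [lra|apply pow2_ge_0]. }
    assert (0 <= D1 * eps ^ 2) by (apply Rmult_le_pos; lra). lra.
Qed.

(** Written as [q * d_X x] at the final time, [f0] is a product of functions with
    bounded derivatives on the open interval. *)
Lemma initial_density_lipschitz : exists L, 0 <= L /\
  forall Y Z, a < Y -> Y <= Z -> Z < b -> Rabs (f0 Z - f0 Y) <= L * (Z - Y).
Proof.
  destruct density_jet_bounded as [Bq [HBq0 HBq]].
  exists (Bq * B + Bq * B). split; [assert (0 <= Bq * B) by (apply Rmult_le_pos; lra); lra|].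
  intros Y Z HY HYZ HZ.
  assert (Jq : jet 1 Y Z Bq (density_jet T)).
  { split; [|split; [|lra]].
    - intros k Hk y Hy. apply is_derive_D_in, density_jet_derive; auto; try lia; lra.
    - intros k Hk y Hy. apply HBq; try lia; lra. }
  assert (Tq := taylor1 _ _ _ _ Jq Y Z ltac:(lra) ltac:(lra)).
  assert (Tx := taylor1 _ _ _ _ (jet_x 1 1 T ltac:(lia) ltac:(lra)) Y Z
                  ltac:(lra) ltac:(lra)).
  cbn [Nat.add density_jet] in Tq, Tx.
  assert (Q := HBq 0%nat ltac:(lia) Y T ltac:(lra) ltac:(lra)). cbn [density_jet] in Q.
  assert (XY := x10_range Y T ltac:(lra) ltac:(lra)).
  assert (XZ := x10_range Z T ltac:(lra) ltac:(lra)).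
  assert (XZ' : Rabs (x 1%nat 0%nat Z T) <= B) by (rewrite Rabs_pos_eq; lra).
  rewrite (Rabs_pos_eq (Z - Y)) in Tq, Tx by lra.
  replace (f0 Z - f0 Y) with
    ((f0 Z / x 1%nat 0%nat Z T - f0 Y / x 1%nat 0%nat Y T) * x 1%nat 0%nat Z T
     + f0 Y / x 1%nat 0%nat Y T * (x 1%nat 0%nat Z T - x 1%nat 0%nat Y T))
    by (field; lra).
  eapply Rle_trans; [apply Rabs_plus_le; apply Rabs_mult_le; eassumption|]. lra.
Qed.

(** Next to a fixed end, a node moves by [O(h)] in one time step, so that the scheme
    bounds the jump of the flux there by [O(h^2 / tau)]. *)
Lemma end_gradient_jump : exists C, 0 <= C /\ forall N M xh n i,
  (1 <= N)%nat -> (2 <= M)%nat -> numerical_solution c a b T m f0 N M xh ->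
  (n < N)%nat -> i = 1%nat \/ i = (M - 1)%nat ->
  let h := step a b M in
  Rabs (D_h h (xh (S n)) (i + 1) - D_h h (xh (S n)) i)
    <= C * (h + h ^ 2 / (T / INR N)).
Proof.
  assert (Hg := glo_ghi).
  destruct initial_density_lipschitz as [L [HL HLip]].
  destruct (mobility_bounds c m bf Bf glo ghi ltac:(lra) (conj Hbf Bf_ge) ltac:(lra))
    as [al [A [L' [Hal [_ Hmob]]]]].
  assert (Hbi : 0 < / bf) by (apply Rinv_0_lt_compat; lra).
  assert (HBi : 0 < / Bf) by (apply Rinv_0_lt_compat; lra).
  assert (HA : 0 < A).
  { destruct (Hmob bf glo glo ltac:(lra) ltac:(lra) ltac:(lra)) as [H _]. lra. }
  set (Kf := 1 + (/ bf) ^ 2).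
  assert (HKf : 0 < Kf) by (unfold Kf; assert (X := pow2_ge_0 (/ bf)); lra).
  set (C1 := Bf * (Kf * (A * ghi))).
  assert (HC1 : 0 <= C1).
  { unfold C1. repeat apply Rmult_le_pos; lra. }
  assert (HC2 : 0 <= L * / bf) by (apply Rmult_le_pos; lra).
  exists (C1 + L * / bf). split; [lra|].
  intros N M xh n i HN HM Hnum Hn Hi h.
  assert (Hh := step_pos M HM). fold h in Hh. assert (Htau := tau_pos N HN).
  set (tau := T / INR N) in *.
  assert (Hi' : (1 <= i <= M - 1)%nat) by lia.
  assert (Gw := numerical_gradient_in N M xh HN HM Hnum n ltac:(lia)).
  assert (Gw' := numerical_gradient_in N M xh HN HM Hnum (S n) ltac:(lia)).
  assert (Hy1 := numerical_density_range N M xh HN HM Hnum (S n) ltac:(lia) i ltac:(lia)).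
  assert (Hy2 := numerical_density_range N M xh HN HM Hnum (S n) ltac:(lia)
                   (i + 1)%nat ltac:(lia)).
  destruct (numerical_implicit_step N M xh HN HM Hnum n Hn) as [Hs [E0 EM]].
  specialize (Hs i Hi'). fold h tau in Hs. fold h in Gw, Gw', Hy1, Hy2 |- *.
  set (w := xh n) in *. set (w' := xh (S n)) in *.
  assert (Hmove : Rabs (w' i - w i) <= h * ghi).
  { assert (Hd : forall j, (1 <= j <= M)%nat -> Rabs (D_h h w' j - D_h h w j) <= ghi).
    { intros j Hj. specialize (Gw j Hj). specialize (Gw' j Hj). apply Rabs_le. lra. }
    (* The other end of the cell next to the boundary does not move. *)
    assert (Hend : exists j, (1 <= j <= M)%nat /\
       Rabs (w' i - w i) = h * Rabs (D_h h w' j - D_h h w j)).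
    { destruct Hi as [-> | ->].
      - exists 1%nat. split; [lia|].
        rewrite <- (Rabs_pos_eq h) at 1 by lra. rewrite <- Rabs_mult. f_equal.
        unfold D_h. simpl (1 - 1)%nat. rewrite E0. field. lra.
      - exists M. split; [lia|].
        rewrite <- (Rabs_pos_eq h) at 1 by lra. rewrite <- Rabs_mult, <- Rabs_Ropp.
        f_equal. unfold D_h. rewrite EM. field. lra. }
    destruct Hend as [j [Hj ->]]. apply Rmult_le_compat_l; [lra|auto]. }
  assert (HDt : glo <= Dt_h h M w i <= ghi).
  { rewrite Dt_h_interior by (auto; lra).
    assert (X1 := Gw i ltac:(lia)). assert (X2 := Gw (i + 1)%nat ltac:(lia)). lra. }
  destruct (Hmob (f0 (node a b M i)) _ _
              (Hf0 _ (node_range M HM i ltac:(lia))) HDt HDt) as [[Hm1 Hm2] _].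
  set (mu := mobility c m _ _) in *.
  assert (R1 := half_node_range M HM i ltac:(lia)).
  assert (R2 := half_node_range M HM (i + 1) ltac:(lia)).
  assert (F1 := Hf0 (half_node a b M i) ltac:(lra)).
  assert (F2 := Hf0 (half_node a b M (i + 1)) ltac:(lra)).
  assert (HLf := HLip (half_node a b M i) (half_node a b M (i + 1)) ltac:(lra)
    ltac:(rewrite half_node_S, half_node_eq; fold h; lra) ltac:(lra)).
  replace (half_node a b M (i + 1) - half_node a b M i) with h in HLf
    by (rewrite half_node_S, half_node_eq; fold h; field).
  set (f1 := f0 (half_node a b M i)) in *.
  set (f2 := f0 (half_node a b M (i + 1))) in *.
  set (d1 := D_h h w' i) in *. set (d2 := D_h h w' (i + 1)) in *.
  assert (Hjump : Rabs (flux c (d2 / f2) - flux c (d1 / f1)) <= A * ghi * (h ^ 2 / tau)).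
  { replace (flux c (d2 / f2) - flux c (d1 / f1)) with (h / tau * (mu * (w' i - w i))).
    2: { replace (h / tau * (mu * (w' i - w i))) with (h * (mu * ((w' i - w i) / tau)))
           by (field; lra). rewrite Hs. field. lra. }
    assert (Hht : 0 < h / tau) by (apply Rdiv_lt_0_compat; lra).
    replace (A * ghi * (h ^ 2 / tau)) with (h / tau * (A * (h * ghi))) by (field; lra).
    apply Rabs_mult_le; [apply Req_le, Rabs_pos_eq; lra|].
    apply Rabs_mult_le; [rewrite Rabs_pos_eq; lra|exact Hmove]. }
  assert (Hgap := flux_gap c (/ bf) (d2 / f2) (d1 / f1) ltac:(lra) ltac:(lra)).
  fold Kf in Hgap.
  assert (Hgap' : Rabs (d2 / f2 - d1 / f1) <= Kf * (A * ghi * (h ^ 2 / tau))).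
  { eapply Rle_trans; [exact Hgap|]. apply Rmult_le_compat_l; lra. }
  replace (d2 - d1) with (f2 * (d2 / f2 - d1 / f1) + (f2 - f1) * (d1 / f1))
    by (field; lra).
  eapply Rle_trans.
  { apply Rabs_plus_le; apply Rabs_mult_le.
    - rewrite Rabs_pos_eq; [apply F2|lra].
    - exact Hgap'.
    - exact HLf.
    - rewrite Rabs_pos_eq; [apply Hy1|lra]. }
  assert (Hht2 : 0 <= h ^ 2 / tau).
  { apply Rlt_le, Rdiv_lt_0_compat; [apply pow_lt|]; lra. }
  assert (0 <= C1 * h) by (apply Rmult_le_pos; lra).
  assert (0 <= L * / bf * (h ^ 2 / tau)) by (apply Rmult_le_pos; lra).
  replace (Bf * (Kf * (A * ghi * (h ^ 2 / tau)))) with (C1 * (h ^ 2 / tau))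
    by (unfold C1; ring).
  lra.
Qed.

(** The one-sided quotient at an end extrapolates, and need not be positive on coarse
    grids.  For [h ^ 2 / tau] small, the jump of the gradient is small; for [tau] of
    order [h ^ 2] or less, the gradient error is so small that its [L^2] norm controls
    it pointwise. *)
Lemma Dt_h_lower_bound : exists h0, 0 < h0 /\ forall N M xh n i,
  (1 <= N)%nat -> (2 <= M)%nat -> numerical_solution c a b T m f0 N M xh ->
  (n <= N)%nat -> (i <= M)%nat -> step a b M <= h0 ->
  glo / 2 <= Dt_h (step a b M) M (xh n) i.
Proof.
  assert (Hg := glo_ghi).
  destruct end_gradient_jump as [C1 [HC1 Hjump]].
  destruct Dt_h_consistency as [C2 [HC2 Hcons]].
  destruct gradient_error as [C3 [HC3 Herr]].
  (* For [h ^ 2 <= eps * tau] and [h <= eps], the jump [C1 * (h + h ^ 2 / tau)] is at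
     most [glo]; [h1] and [h2] serve the opposite regime. *)
  set (eps := glo / (2 * (C1 + 1))).
  assert (Heps : 0 < eps) by (apply Rdiv_lt_0_compat; lra).
  set (Q := 6 * (C3 * (/ eps + 1) ^ 2)).
  assert (HQ : 0 <= Q).
  { unfold Q. apply Rmult_le_pos; [lra|]. apply Rmult_le_pos; [lra|apply pow2_ge_0]. }
  set (h1 := (glo / 4) ^ 2 / (2 * Q + 1)). set (h2 := glo / (4 * (C2 + 1))).
  assert (Hh1 : 0 < h1) by (apply Rdiv_lt_0_compat; [apply pow_lt|]; lra).
  assert (Hh2 : 0 < h2) by (apply Rdiv_lt_0_compat; lra).
  exists (Rmin (Rmin 1 eps) (Rmin h1 h2)).
  split. { repeat apply Rmin_case; lra. }
  intros N M xh n i HN HM Hnum Hn Hi Hhle.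
  assert (Hh := step_pos M HM). assert (Htau := tau_pos N HN).
  set (h := step a b M) in *.
  assert (Hle1 : h <= 1 /\ h <= eps /\ h <= h1 /\ h <= h2).
  { assert (X1 := Rmin_l (Rmin 1 eps) (Rmin h1 h2)).
    assert (X2 := Rmin_r (Rmin 1 eps) (Rmin h1 h2)).
    assert (X3 := Rmin_l 1 eps). assert (X4 := Rmin_r 1 eps).
    assert (X5 := Rmin_l h1 h2). assert (X6 := Rmin_r h1 h2). lra. }
  clear Hhle. destruct Hle1 as [L1 [L2 [L3 L4]]].
  assert (Gw := numerical_gradient_in N M xh HN HM Hnum n Hn). fold h in Gw.
  assert (Hcases : (1 <= i <= M - 1)%nat \/ i = 0%nat \/ i = M) by lia.
  destruct Hcases as [Hint|Hend].
  { rewrite Dt_h_interior by (auto; lra).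
    assert (X1 := Gw i ltac:(lia)). assert (X2 := Gw (i + 1)%nat ltac:(lia)). lra. }
  destruct (Rle_dec (h ^ 2) (eps * (T / INR N))) as [Hbig|Hsmall].
  - assert (Hvar : forall k, k = 1%nat \/ k = (M - 1)%nat ->
      Rabs (D_h h (xh n) (k + 1) - D_h h (xh n) k) <= glo).
    { intros k Hk. destruct n as [|n].
      - destruct Hnum as [_ [H0 _]]. unfold D_h.
        rewrite !H0, Nat.add_sub, node_S, node_pred by lia. fold h.
        replace (_ - _) with 0 by (field; lra). rewrite Rabs_R0. lra.
      - eapply Rle_trans; [apply (Hjump N M xh n k); auto|]. fold h.
        assert (Hr : h ^ 2 / (T / INR N) <= eps).
        { apply Rmult_le_reg_r with (T / INR N); [exact Htau|].
          unfold Rdiv at 1. rewrite Rmult_assoc, Rinv_l, Rmult_1_r by lra. exact Hbig. }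
        apply Rle_trans with (C1 * (2 * eps)); [apply Rmult_le_compat_l; lra|].
        replace glo with (2 * eps * (C1 + 1)) at 1 by (unfold eps; field; lra). nra. }
    destruct Hend as [-> | ->].
    + rewrite Dt_h_left by lra.
      assert (X := Hvar 1%nat ltac:(auto)). simpl (1 + 1)%nat in X.
      apply Rabs_le_between in X. assert (X1 := Gw 1%nat ltac:(lia)). lra.
    + rewrite Dt_h_right by (auto; lra).
      assert (X := Hvar (M - 1)%nat ltac:(auto)).
      replace (M - 1 + 1)%nat with M in X by lia.
      apply Rabs_le_between in X. assert (X1 := Gw M ltac:(lia)). lra.
  - assert (E := Herr N M xh HN HM Hnum n Hn). fold h in E.
    assert (E2 := inner_Dt_h_le h M (error N M xh n) HM Hh).
    assert (E3 := inner_ends h M (Dt_h h M (error N M xh n)) i ltac:(lra) Hend).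
    assert (Ht2 : T / INR N <= / eps * h ^ 2).
    { apply Rmult_le_reg_l with eps; [lra|]. rewrite <- Rmult_assoc, Rinv_r by lra. lra. }
    assert (Hsq : (T / INR N + h ^ 2) ^ 2 <= (/ eps + 1) ^ 2 * h ^ 4).
    { replace ((/ eps + 1) ^ 2 * h ^ 4) with ((/ eps * h ^ 2 + h ^ 2) ^ 2) by ring.
      apply pow_incr. assert (X := pow2_ge_0 h). lra. }
    set (z := Dt_h h M (error N M xh n) i) in *.
    assert (Hz : h * z ^ 2 <= h * (2 * Q * h ^ 3)).
    { assert (X : C3 * (T / INR N + h ^ 2) ^ 2 <= C3 * ((/ eps + 1) ^ 2 * h ^ 4))
        by (apply Rmult_le_compat_l; lra).
      unfold Q. lra. }
    apply Rmult_le_reg_l in Hz; [|exact Hh].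
    assert (Hz2 : z ^ 2 <= (glo / 4) ^ 2).
    { eapply Rle_trans; [exact Hz|].
      assert (X : h ^ 3 <= h).
      { replace (h ^ 3) with (h * h ^ 2) by ring.
        assert (h ^ 2 <= 1) by (replace 1 with (1 ^ 2) by ring; apply pow_incr; lra).
        nra. }
      apply Rle_trans with ((2 * Q + 1) * h1).
      - apply Rmult_le_compat; try lra. apply pow_le; lra.
      - apply Req_le. unfold h1. field. lra. }
    assert (Hz3 : Rabs z <= glo / 4).
    { apply Rnot_lt_le. intros Hlt. rewrite <- (pow2_abs z) in Hz2.
      assert (X := Rabs_pos z). nra. }
    apply Rabs_le_between in Hz3.
    assert (R := time_range N HN n Hn).
    assert (Hc := Hcons M (INR n * (T / INR N)) i HM R Hi). fold h in Hc.
    unfold z in Hz3.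
    unfold error in Hz3. rewrite Dt_h_minus in Hz3 by lra.
    assert (Hp := x10_range (node a b M i) _ (node_range M HM i Hi) R).
    apply Rabs_le_between in Hc.
    assert (Hch : C2 * h ^ 2 <= glo / 4).
    { apply Rle_trans with ((C2 + 1) * h2).
      - apply Rmult_le_compat; try lra; [apply pow2_ge_0|]. nra.
      - apply Req_le. unfold h2. field. lra. }
    lra.
Qed.

Lemma error_estimates : exists C h0 : R, 0 < C /\ 0 < h0 /\
  forall N M xh, (1 <= N)%nat -> (2 <= M)%nat ->
  numerical_solution c a b T m f0 N M xh -> forall n, (n <= N)%nat ->
  let h := step a b M in
  let eps := T / INR N + h ^ 2 in
  norm2 h M (error N M xh n) <= C * eps /\
  norm2 h M (Dt_h h M (error N M xh n)) <= C * eps /\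
  (h <= h0 ->
   norm2 h M (fun i => f0 (node a b M i) / Dt_h h M (xh n) i
     - f0 (node a b M i) / x 1%nat 0%nat (node a b M i) (INR n * (T / INR N)))
   <= C * eps).
Proof.
  assert (Hg := glo_ghi).
  destruct Dt_h_lower_bound as [h0 [Hh0 Hlow]].
  destruct Dt_h_consistency as [C2 [HC2 Hcons]].
  destruct gradient_error as [C3 [HC3 Herr]].
  set (Kd := Bf * / (glo / 2 * beta)).
  assert (Hden : 0 < glo / 2 * beta) by (apply Rmult_lt_0_compat; lra).
  assert (HKd : 0 <= Kd).
  { unfold Kd. apply Rmult_le_pos; [lra|]. apply Rlt_le, Rinv_0_lt_compat, Hden. }
  set (A1 := (b - a) ^ 2 * C3). set (A2 := 6 * C3).
  set (A3 := 2 * Kd ^ 2 * A2 + 2 * Kd ^ 2 * C2 ^ 2 * (b - a)).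
  exists (sqrt A1 + sqrt A2 + sqrt A3 + 1), h0.
  assert (S1 := sqrt_pos A1). assert (S2 := sqrt_pos A2). assert (S3 := sqrt_pos A3).
  split; [lra|]. split; [exact Hh0|].
  intros N M xh HN HM Hnum n Hn h eps.
  assert (Hh := step_pos M HM). assert (Htau := tau_pos N HN). fold h in Hh.
  assert (Hh2 := pow2_ge_0 h).
  assert (Heps : 0 < eps) by (unfold eps; lra).
  assert (R := time_range N HN n Hn).
  assert (E := Herr N M xh HN HM Hnum n Hn). fold h in E. fold eps in E.
  assert (HhM := step_mult M HM). fold h in HhM.
  assert (Hweak : forall s z, s <= sqrt A1 + sqrt A2 + sqrt A3 + 1 ->
     z <= s * eps -> z <= (sqrt A1 + sqrt A2 + sqrt A3 + 1) * eps).
  { intros s z Hs Hz. eapply Rle_trans; [exact Hz|]. apply Rmult_le_compat_r; lra. }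
  assert (EDt : inner h M (Dt_h h M (error N M xh n)) (Dt_h h M (error N M xh n))
                <= A2 * eps ^ 2).
  { eapply Rle_trans; [apply inner_Dt_h_le; auto|]. unfold A2. lra. }
  split; [|split].
  - apply (Hweak (sqrt A1)); [lra|]. apply norm2_le; [lra|].
    eapply Rle_trans; [apply discrete_poincare; auto; try lia|].
    + unfold error. rewrite node_0. destruct (Hends _ R) as [-> _].
      destruct (proj1 Hnum n Hn) as [_ [-> _]]. ring.
    + unfold error. rewrite node_M by exact HM. destruct (Hends _ R) as [_ ->].
      destruct (proj1 Hnum n Hn) as [_ [_ ->]]. ring.
    + rewrite HhM. unfold A1. rewrite Rmult_assoc.
      apply Rmult_le_compat_l; [apply pow2_ge_0|exact E].
  - apply (Hweak (sqrt A2)); [lra|]. apply norm2_le; [lra|exact EDt].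
  - intros Hhle. apply (Hweak (sqrt A3)); [lra|]. apply norm2_le; [lra|].
    set (r := 2 * Kd ^ 2 * C2 ^ 2 * h ^ 4).
    eapply Rle_trans.
    { apply (inner_le h M _ (Dt_h h M (error N M xh n)) (2 * Kd ^ 2) r);
        [lia|lra|]. intros i Hi.
      assert (Hw := Hlow N M xh n i HN HM Hnum Hn Hi Hhle). fold h in Hw.
      assert (Hc := Hcons M _ i HM R Hi). fold h in Hc.
      assert (Hp := x10_range (node a b M i) _ (node_range M HM i Hi) R).
      assert (Hf := Hf0 (node a b M i) (node_range M HM i Hi)).
      set (p := x 1%nat 0%nat (node a b M i) (INR n * (T / INR N))) in *.
      set (z := Dt_h h M (error N M xh n) i).
      assert (Ez : z = Dt_h h M (fun i => x 0%nat 0%nat (node a b M i)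
                         (INR n * (T / INR N))) i - Dt_h h M (xh n) i).
      { unfold z, error. apply Dt_h_minus. lra. }
      set (ue := Dt_h h M (fun i => x 0%nat 0%nat (node a b M i)
                         (INR n * (T / INR N))) i) in *.
      set (w := Dt_h h M (xh n) i) in *.
      set (f := f0 (node a b M i)) in *.
      assert (Hd : Rabs (f / w - f / p) <= Kd * (Rabs z + C2 * h ^ 2)).
      { replace (f / w - f / p) with ((f * / (w * p)) * (z + - (ue - p)))
          by (rewrite Ez; field; lra).
        apply Rabs_mult_le.
        - assert (Hwp : glo / 2 * beta <= w * p) by (apply Rmult_le_compat; lra).
          assert (Hi1 : / (w * p) <= / (glo / 2 * beta))
            by (apply Rinv_le_contravar; lra).
          assert (Hi2 : 0 < / (w * p)) by (apply Rinv_0_lt_compat; lra).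
          rewrite Rabs_pos_eq; [|apply Rmult_le_pos; lra].
          unfold Kd. apply Rmult_le_compat; lra.
        - apply Rabs_plus_le; [apply Rle_refl|apply Rabs_opp_le; exact Hc]. }
      rewrite <- (pow2_abs (f / w - f / p)).
      apply Rle_trans with ((Kd * (Rabs z + C2 * h ^ 2)) ^ 2).
      { apply pow_incr. split; [apply Rabs_pos|exact Hd]. }
      rewrite <- (pow2_abs z). unfold r.
      replace (2 * Kd ^ 2 * Rabs z ^ 2 + 2 * Kd ^ 2 * C2 ^ 2 * h ^ 4) with
        (Kd ^ 2 * (2 * (Rabs z ^ 2 + (C2 * h ^ 2) ^ 2))) by ring.
      rewrite Rpow_mult_distr. apply Rmult_le_compat_l; [apply pow2_ge_0|].
      assert (X := pow2_ge_0 (Rabs z - C2 * h ^ 2)). lra. }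
    rewrite HhM.
    assert (HK2 : 0 <= 2 * Kd ^ 2) by (assert (X := pow2_ge_0 Kd); lra).
    assert (Hh4 : h ^ 4 <= eps ^ 2).
    { replace (h ^ 4) with ((h ^ 2) ^ 2) by ring. apply pow_incr. unfold eps. lra. }
    assert (X1 : 2 * Kd ^ 2 * inner h M (Dt_h h M (error N M xh n))
                   (Dt_h h M (error N M xh n)) <= 2 * Kd ^ 2 * (A2 * eps ^ 2))
      by (apply Rmult_le_compat_l; lra).
    assert (X2 : r * (b - a) <= 2 * Kd ^ 2 * C2 ^ 2 * (b - a) * eps ^ 2).
    { unfold r. replace (2 * Kd ^ 2 * C2 ^ 2 * h ^ 4 * (b - a)) with
        (2 * Kd ^ 2 * C2 ^ 2 * (b - a) * h ^ 4) by ring.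
      apply Rmult_le_compat_l; [|exact Hh4].
      apply Rmult_le_pos; [|lra]. apply Rmult_le_pos; [lra|apply pow2_ge_0]. }
    unfold A3. lra.
Qed.

End ExactSolution.

Theorem theorem4p3 :
  exists K : nat,
  forall (c : traj_case) (a b T m bf Bf : R) (f0 : R -> R)
         (x : nat -> nat -> R -> R -> R),
    a < b -> 0 < T -> 1 < m ->
    0 < bf -> (forall X, a <= X <= b -> bf <= f0 X <= Bf) ->
    smooth_upto K a b T x ->
    exact_solution c a b T m f0 x ->
    exists C h0 : R, 0 < C /\ 0 < h0 /\
      forall (N M : nat) (xh : nat -> nat -> R),
        (1 <= N)%nat -> (2 <= M)%nat ->
        let h := step a b M in
        let tau := T / INR N in
        let xe := fun n i => x 0%nat 0%nat (node a b M i) (INR n * tau) in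
        let e := fun n i => xe n i - xh n i in
        let fe := fun n i =>
          f0 (node a b M i) / x 1%nat 0%nat (node a b M i) (INR n * tau) in
        let fh := fun n i => f0 (node a b M i) / Dt_h h M (xh n) i in
        (forall n, (n <= N)%nat -> in_Q a b M (xe n)) ->
        numerical_solution c a b T m f0 N M xh ->
        forall n, (n <= N)%nat ->
          norm2 h M (e n) <= C * (tau + h ^ 2) /\
          norm2 h M (Dt_h h M (e n)) <= C * (tau + h ^ 2) /\
          (h <= h0 -> norm2 h M (fun i => fh n i - fe n i) <= C * (tau + h ^ 2)).
Proof.
  (* The second difference of [x] in space is expanded up to its fourth derivative. *)
  exists 4%nat.
  intros c a b T m bf Bf f0 x Hab HT Hm Hbf Hf0 Hx [Hpos [Heq [Hends Hinit]]].
  destruct (smooth_upto_bounded 4 a b T x ltac:(lra) ltac:(lra) Hx) as [B HB].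
  destruct (continuous_on_rectangle_positive a b T (x 1%nat 0%nat) ltac:(lra) ltac:(lra)
              (proj1 (Hx 1%nat 0%nat) ltac:(lia)) Hpos) as [beta [Hbeta Hx10]].
  destruct (error_estimates c a b T m bf Bf (Rmax B (b - a)) beta f0 x)
    as [C [h0 [HC [Hh0 Hest]]]]; auto.
  - intros j k Hjk X t HX Ht. apply (proj2 (Hx j k) Hjk X t HX Ht).
  - intros j k Hjk X t HX Ht. apply (proj2 (Hx j k) Hjk X t HX Ht).
  - intros j k Hjk X t HX Ht. eapply Rle_trans; [|apply Rmax_l]. auto.
  - apply Rmax_r.
  - exists C, h0. split; [exact HC|]. split; [exact Hh0|].
    intros N M xh HN HM h tau xe e fe fh _ Hnum n Hn.
    exact (Hest N M xh HN HM Hnum n Hn).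
Qed.
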